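(* Each of the 16 integral MP moves is derived as a sequence of the primary integral MP move, the integral pure sliding moves, the integral H-move and their inverses. That is: if a framed integral normal o-graph $(\Gamma',x')$ is obtained from a framed integral normal o-graph $(\Gamma,x)$ by an integral MP move, then $(\Gamma',x')$ is obtained from $(\Gamma,x)$ by a finite sequence of primary integral MP moves, integral pure sliding moves, integral H-moves, and inverses of these moves.
   Context: **Normal o-graphs.** A normal o-graph is an oriented virtual link diagram (real crossings with sign $+$ or $-$) up to planar isotopy and the Reidemeister-type moves involving virtual crossings. Equivalently, it is the following data up to isomorphism: a finite nonempty set $V$ of vertices (real crossings), a sign in $\{+,-\}$ for each vertex, four ends (over-in, over-out, under-in, under-out) at each vertex, and a bijection from the set of all out-ends to the set of all in-ends (each matched pair is an edge), such that the resulting 4-valent graph is connected. **Dual branched triangulation.** $T(\Gamma)$: for each vertex of $\Gamma$ take a tetrahedron with ordered vertices $0<1<2<3$; let $F_i$ be the face opposite to $i$. At a positive vertex the frame $(01,02,03)$ is negative, and over-in, over-out, under-in, under-out correspond to $F_0,F_1,F_2,F_3$. At a negative vertex the frame $(01,02,03)$ is positive, and over-in, over-out, under-in, under-out correspond to $F_1,F_0,F_3,F_2$. For each edge of $\Gamma$ glue the two corresponding faces by the order-preserving affine map. $\Gamma\mapsto T(\Gamma)$ is a bijection from normal o-graphs to connected finite complexes of oriented tetrahedra with ordered vertices and order-preserving, orientation-reversing pairings of all faces (up to isomorphism). Edges of $T(\Gamma)$ are directed from smaller to larger end. The dual 2-skeleton $P(\Gamma)$ is a branched standard polyhedron whose true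 vertices, edges, 2-cells are dual to tetrahedra, triangles, edges of $T(\Gamma)$. All moves are described on $T(\Gamma)$. **Closed.** Let $M(\Gamma)$ be the regular neighbourhood of $P(\Gamma)$, $v(\Gamma)$ the nowhere-vanishing field on it positively transverse to (the smoothed) $P(\Gamma)$, crossing each 2-cell in the direction of the dual edge. $\Gamma$ is closed if $\partial M(\Gamma)\cong S^2$ with the parts where $v(\Gamma)$ points outward, is tangent, points inward being $\{z<0\},\{z=0\},\{z>0\}$. **Weights and Euler cochain.** An integral normal o-graph is $(\Gamma,x)$ with $x$ an integer weight on each edge of $\Gamma$, i.e. on each triangle of $T(\Gamma)$; so $x\in C^1(P(\Gamma);\mathbb{Z})$. For an edge $E$ of a triangle $f$ put $\sigma(f,E)=-1$ if $E$ joins the smallest and largest vertices of $f$ and $+1$ otherwise. Then $(\delta x)(E)=\sum_f\sigma(f,E)x(f)$, summing over all occurrences of triangles around $E$. A corner of a tetrahedron at its edge $02$ or $13$ carries one dot, at its other edges none (these dots are the tangency points to the 2-cells of the field crossing the edges of $P$ from left to right). If $n_E$ is the number of dots around $E$, the Euler cochain is $c_P(E)=-(1-n_E/2)$. A framed integral normal o-graph is an integral closed normal o-graph $(\Gamma,x)$ with $\delta x=c_P$. **MP moves.** Two distinct tetrahedra glued along a triangle $c<d<e$, with remaining vertices $a,b$ (five abstractly distinct vertices of a bipyramid $B$); choose a total order on $\{a,b,c,d,e\}$ extending both orders, such that $a,b$ are not both smaller than $c$ and not both larger than $e$; replace by the three tetrahedra $\{a,b,c,d\},\{a,b,d,e\},\{a,b,c,e\}$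 around a new edge $ab$, with restricted orders and unchanged outer gluings (16 types). **Integral MP moves.** Assume $x=0$ on the triangle $cde$ (parallel weights outside are arbitrary). Let $w$ be an integer function on the nine triangles of the subdivided $B$ (six outer triangles, three inner triangles $abc,abd,abe$) such that for each of the nine outer edges $E$ of $B$, $\sum_{f\ni E}\sigma(f,E)w(f)=\frac12(d'(E)-d(E))$, where $d(E),d'(E)$ are the numbers of dots at $E$ in the two, resp. three, tetrahedra, and $\sum_{f\ni ab}\sigma(f,ab)w(f)=-1+\frac12d'(ab)$. Such $w$ exists and is unique up to changes realized by integral H-moves at the three new vertices; for each type one such $w$ is fixed. The integral MP move performs the MP move, gives inner triangles weight $w$, and adds to the weights of the other triangles the values of $w$ on the outer triangles of $B$ (added up if outer triangles of $B$ are identified). **Primary integral MP move.** Five vertices $v_0<\dots<v_4$; $\{v_0,v_1,v_2,v_4\},\{v_0,v_2,v_3,v_4\}$ replaced by $\{v_1,v_2,v_3,v_4\},\{v_0,v_1,v_3,v_4\},\{v_0,v_1,v_2,v_3\}$, all five corresponding to positive vertices, with $w=0$. **Integral H-move.** At a vertex of $\Gamma$, add $+1$ to the weights of the two incoming edges and $-1$ to the weights of the two outgoing edges (added up if an edge occurs twice). **Pure sliding moves.** Let $E$ be an edge of $T(\Gamma)$ with ends $x_0<y_0$; choose triangles $f_1,f_2$ at two different places around $E$ (a triangle may first be replaced by a stack of two parallel copies, so $f_1,f_2$ may be parallel copies of one triangle). Let $p,q$ be their third vertices. Choose a total order on $\{x_0,y_0,p,q\}$ compatible with $f_1,f_2$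 with $p,q$ not both smaller than $x_0$ and not both larger than $y_0$. Cut open along $f_1\cup f_2$ and insert a pillow of two oppositely oriented tetrahedra, both with vertices $x_0,y_0,p,q$ in this order, glued to each other along $x_0pq$ and $y_0pq$, the four outer faces being glued to the sides of the cut. So $f_i$ is replaced by two triangles $f_i',f_i''$, $E$ by two edges $E',E''$, and a new edge $pq$ and two inner triangles $x_0pq,y_0pq$ appear. **Integral pure sliding moves.** From $(\Gamma,x)$ to $(\Gamma',x')$: the underlying move is a pure sliding move; if $f_1,f_2$ are parallel copies of one triangle, its weight is distributed between them as a sum of two integers. $x'=x$ on all triangles other than $f_i',f_i'',x_0pq,y_0pq$, and on these six $x'$ satisfies: (i) for each $s\in\{x_0,y_0\}$, $(i,r)\in\{(1,p),(2,q)\}$: $\sigma(f_i,sr)(x'(f_i')+x'(f_i''))+\sigma(spq,sr)x'(spq)=\sigma(f_i,sr)x(f_i)+\epsilon(sr)$, where $\epsilon(sr)=1$ if $sr$ is the edge $02$ or $13$ of the ordered tetrahedron $x_0y_0pq$ and $0$ otherwise; (ii) $\sigma(x_0pq,pq)x'(x_0pq)+\sigma(y_0pq,pq)x'(y_0pq)=-1+\epsilon(pq)$; (iii) $(\delta x')=c_{P'}$ at $E'$ and $E''$. (Parallel copies of a triangle remaining after the move are merged, adding weights.) These conditions determine $x'$ up to integral H-moves at the two new vertices. *)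

(* Defs.v *)
From HB Require Import structures.
From mathcomp Require Import all_boot all_order all_algebra all_fingroup.
From mathcomp Require Import all_classical reals topology normedtype.
From Stdlib Require Import Relation_Operators.
Import numFieldNormedType.Exports.

Set Implicit Arguments.
Unset Strict Implicit.
Unset Printing Implicit Defensive.

(* A pair (v, o) : V * bool stands both for an out-end and for an in-end of the
   vertex v; o = true means "over", o = false means "under".  The matching of
   all out-ends with all in-ends is then a permutation of V * bool. *)
Definition ograph_adj (V : finType) (e : {perm (V * bool)}) : rel V :=
  fun u v => [exists o : bool, ((e (u, o)).1 == v) || ((e (v, o)).1 == u)].

(* Normal o-graphs; sgn v = true means that v is positive. *)
Record ograph := Ograph {
  vertex : finType;
  sgn : vertex -> bool;
  edge : {perm (vertex * bool)};
  ograph_nonempty : 0 < #|vertex|;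
  ograph_connected : forall u v : vertex, connect (ograph_adj edge) u v }.

(* F_k is the face of the tetrahedron 0123 opposite to k. *)
Definition in_face (s over : bool) : 'I_4 :=
  match s, over with
  | true, true => @Ordinal 4 0 isT
  | true, false => @Ordinal 4 2 isT
  | false, true => @Ordinal 4 1 isT
  | false, false => @Ordinal 4 3 isT
  end.

Definition out_face (s over : bool) : 'I_4 :=
  match s, over with
  | true, true => @Ordinal 4 1 isT
  | true, false => @Ordinal 4 3 isT
  | false, true => @Ordinal 4 0 isT
  | false, false => @Ordinal 4 2 isT
  end.

(* (v, k) is the face F_k of the tetrahedron dual to v. *)
Definition face (G : ograph) : Type := (vertex G * 'I_4)%type.

(* For both signs, the over ends are F_0, F_1 and the under ends F_2, F_3. *)
Definition over_face (k : 'I_4) : bool := k < 2.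

Definition outgoing (G : ograph) (F : face G) : bool :=
  F.2 == out_face (sgn F.1) (over_face F.2).

(* Edges of G, i.e. triangles of T(G), are named by their out-ends. *)
Definition triangle_of (G : ograph) (F : face G) : vertex G * bool :=
  let e := (F.1, over_face F.2) in
  if outgoing F then e else ((edge G)^-1)%g e.

Definition tri_out (G : ograph) (e : vertex G * bool) : face G :=
  (e.1, out_face (sgn e.1) e.2).

Definition tri_in (G : ograph) (e : vertex G * bool) : face G :=
  let e' := edge G e in (e'.1, in_face (sgn e'.1) e'.2).

(* The face glued to F. *)
Definition glue (G : ograph) (F : face G) : face G :=
  if outgoing F then tri_in (triangle_of F) else tri_out (triangle_of F).

(* (t, i, j), with i != j, is the edge ij of the tetrahedron t. *)
Definition corner (G : ograph) : finType := (vertex G * 'I_4 * 'I_4)%type.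

(* The vertices of a face F_k are numbered by 'I_3 through the increasing map
   lift k, so order-preserving gluings preserve these numbers. *)
Definition fcorner (G : ograph) (F : face G) (m n : 'I_3) : corner G :=
  (F.1, lift F.2 m, lift F.2 n).

Definition corner_adj (G : ograph) : rel (corner G) := fun c c' =>
  [exists F : vertex G * 'I_4, exists m : 'I_3, exists n : 'I_3,
    (c == @fcorner G F m n) && (c' == fcorner (@glue G F) m n)].

(* Edges of T(G) are the classes of this relation on corners (t, i, j), i < j. *)
Definition same_edge (G : ograph) : rel (corner G) := connect (@corner_adj G).

(* The boundary of M(G) is the link of the ideal vertices of T(G): it is made of
   one triangle for each vertex i of each tetrahedron t, whose corners lie on
   the edges ij.  A point of it is given by its barycentric coordinates l j with
   respect to these corners (and l i = 0); its side in F_k is l k = 0. *)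
Definition link_pt (G : ograph) (R : realType) : Type :=
  (vertex G * 'I_4 * 'rV[R]_4)%type.

Definition in_link (R : realType) (i : 'I_4) : set 'rV[R]_4 := fun l =>
  [/\ l ord0 i = 0%R, forall j, (0 <= l ord0 j)%R & (\sum_j l ord0 j = 1)%R].

Definition link_glue (G : ograph) (R : realType) (a b : link_pt G R) : Prop :=
  exists (F : face G) (m : 'I_3),
    [/\ a.1 = (F.1, lift F.2 m),
        b.1 = ((glue F).1, lift (glue F).2 m),
        a.2 ord0 F.2 = 0%R,
        b.2 ord0 (glue F).2 = 0%R
      & forall n : 'I_3, a.2 ord0 (lift F.2 n) = b.2 ord0 (lift (glue F).2 n)].

(* The field crosses the 2-cell dual to ij from the smaller to the larger end of
   ij.  Hence on the link triangle of i it points out of M(G) at the corner ij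
   if j < i and into M(G) if i < j; the outward part is the set of the points
   closer to the corners of the first kind, and tangency happens on the segment
   (if any) in between. *)
Definition inwardness (R : realType) (i : 'I_4) (l : 'rV[R]_4) : R :=
  (\sum_(j : 'I_4 | (i < j)%N) l ord0 j - \sum_(j : 'I_4 | (j < i)%N) l ord0 j)%R.

Definition on_sphere (R : realType) (z : 'rV[R]_3) : Prop :=
  (\sum_j z ord0 j ^+ 2 = 1)%R.

(* h is a continuous map from the disjoint union of the link triangles onto the
   unit sphere whose fibres are exactly the classes of glued points; by
   compactness it is the same as a homeomorphism from the boundary of M(G). *)
Definition closed_ograph (R : realType) (G : ograph) : Prop :=
  exists h : vertex G * 'I_4 -> 'rV[R]_4 -> 'rV[R]_3,
  [/\ forall s, {within @in_link R s.2, continuous (h s)}%classic,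
      forall s l, in_link s.2 l -> on_sphere (h s l),
      forall z, on_sphere z -> exists s l, in_link s.2 l /\ h s l = z,
      forall s l s' l', in_link s.2 l -> in_link s'.2 l' ->
        (h s l = h s' l' <->
         clos_refl_sym_trans (link_pt G R) (@link_glue G R) (s, l) (s', l'))
    & forall s l, in_link s.2 l ->
        [/\ (h s l ord0 ord_max < 0)%R <-> (inwardness s.2 l < 0)%R,
            h s l ord0 ord_max = 0%R <-> inwardness s.2 l = 0%R
          & (0 < h s l ord0 ord_max)%R <-> (0 < inwardness s.2 l)%R]].

Record iograph := Iograph {
  igraph :> ograph;
  weight : vertex igraph * bool -> int }.

(* The weight of the triangle of which F is one of the two sides. *)
Definition fwt (X : iograph) (F : face X) : int := weight (triangle_of F).

(* sigma(f, E) for the triangle f = {a, b, c} and its edge E = {a, b}. *)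
Definition sigma (a b c : nat) : int :=
  (if (minn a b < c < maxn a b)%N then -1 else 1)%R.

(* ij is the edge 02 or 13 of a tetrahedron 0123. *)
Definition dotted (i j : nat) : bool :=
  (i, j) \in [:: (0, 2); (2, 0); (1, 3); (3, 1)].

(* Each triangle is counted once, through its face at the out-end, and the third
   vertex of its edge mn is 3 - m - n. *)
Definition delta (X : iograph) (c : corner X) : int :=
  (\sum_(e : vertex X * bool)
    \sum_(m : 'I_3)
      \sum_(n : 'I_3 | (m < n)%N && same_edge c (fcorner (tri_out e) m n))
        sigma m n (3 - m - n)%N * weight e)%R.

Definition ndots (G : ograph) (c : corner G) : nat :=
  #|[pred c' : corner G |
      [&& same_edge c c', c'.1.2 < c'.2 & dotted c'.1.2 c'.2]]|.

Definition euler (G : ograph) (c : corner G) : rat :=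
  (- (1 - (ndots c)%:R / 2%:R))%R.

Definition framed (R : realType) (X : iograph) : Prop :=
  closed_ograph R X /\
  forall (t : vertex X) (i j : 'I_4), i < j ->
    ((@delta X (t, i, j))%:~R = @euler X (t, i, j) :> rat)%R.

(* X' is isomorphic to X with the weights modified by d. *)
Definition reweighting (X X' : iograph) (d : vertex X * bool -> int) : Prop :=
  exists f : vertex X -> vertex X',
  [/\ bijective f,
      forall v, sgn (f v) = sgn v,
      forall v o, edge X' (f v, o) = (f (edge X (v, o)).1, (edge X (v, o)).2)
    & forall v o, weight (f v, o) = (weight (v, o) + d (v, o))%R].

Definition iso (X X' : iograph) : Prop := @reweighting X X' (fun _ => 0%R).

Definition hmove (X X' : iograph) : Prop :=
  exists v : vertex X,
    @reweighting X X' (fun e => ((edge X e).1 == v)%:Z - (e.1 == v)%:Z)%R.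

(* The index of i != k among the elements other than k; inverse of lift k. *)
Definition idx (n : nat) (k i : 'I_n.+2) : 'I_n.+1 := odflt ord0 (unlift k i).

Definition push (G G' : ograph) (iota : vertex G -> vertex G') (F : face G) :
  face G' := (iota F.1, F.2).

(* The vertices a, b, c, d, e are labelled by 'I_5 according to their total
   order, and K is the set {a, b}.  D_i is the tetrahedron with the four vertices
   other than i; the bipyramid is subdivided into the D_i with i in K, or
   into the D_i with i not in K.  D_i and D_j meet in the triangle ~: [set i; j],
   which is opposite to idx i j in D_i and to idx j i in D_j. *)
Definition mp_type (K : {set 'I_5}) : Prop :=
  [/\ #|K| = 2,
      ~ (forall a c, a \in K -> c \notin K -> a < c)
    & ~ (forall a c, a \in K -> c \notin K -> c < a)].

(* The number of dots at the edge ab in the tetrahedra D_i with i in S. *)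
Definition mp_dots (S : {set 'I_5}) (a b : 'I_5) : nat :=
  #|[set i in S | [&& i != a, i != b & dotted (idx i a) (idx i b)]]|.

(* w is a function of the triangles, i.e. of the subsets of 'I_5 with three
   elements; its value at the triangle cde = ~: K is irrelevant. *)
Definition mp_coboundary (K : {set 'I_5}) (w : {set 'I_5} -> int)
    (a b : 'I_5) : int :=
  (\sum_(c : 'I_5 | [&& c != a, c != b & [set a; b; c] != ~: K])
     sigma a b c * w [set a; b; c])%R.

Definition mp_admissible (K : {set 'I_5}) (w : {set 'I_5} -> int) : Prop :=
  forall a b : 'I_5, a < b ->
    ((mp_coboundary K w a b)%:~R =
      if [set a; b] == K then -1 + (mp_dots (~: K) a b)%:R / 2%:R
      else ((mp_dots (~: K) a b)%:R - (mp_dots K a b)%:R) / 2%:R :> rat)%R.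

(* tau i is the tetrahedron of X which is D_i if i is in K, and tau' i the one
   of X' if i is not in K; iota is the bijection between the other tetrahedra.
   F and F' are corresponding faces of tetrahedra in X and in X', on the
   boundary of the bipyramid or outside it. *)
Definition mp_corr (K : {set 'I_5}) (X X' : iograph) (tau : 'I_5 -> vertex X)
    (tau' : 'I_5 -> vertex X') (iota : vertex X -> vertex X')
    (F : face X) (F' : face X') : Prop :=
  (F.1 \notin tau @: K /\ F' = push iota F) \/
  (exists i j : 'I_5, [/\ i \in K, j \notin K,
                          F = (tau i, idx i j) & F' = (tau' j, idx j i)]).

(* w on F' if F' is an outer triangle of the bipyramid, and 0 otherwise. *)
Definition mp_outer (K : {set 'I_5}) (X' : iograph) (tau' : 'I_5 -> vertex X')
    (w : {set 'I_5} -> int) (F' : face X') : int :=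
  (\sum_(i in K) \sum_(j in ~: K | F' == (tau' j, idx j i)) w (~: [set i; j]))%R.

(* Orientations: the boundary of the simplex 01234 induces on D_i (-1)^i times
   the orientation given by the order, up to a global sign eps, and the two
   subdivisions of the bipyramid inherit opposite orientations from it. *)
Definition mp_move (eps : bool) (K : {set 'I_5}) (w : {set 'I_5} -> int)
    (X X' : iograph) : Prop :=
  exists (tau : 'I_5 -> vertex X) (tau' : 'I_5 -> vertex X')
         (iota : vertex X -> vertex X'),
  [/\ [/\ {in K &, injective tau}, {in ~: K &, injective tau'},
          {in ~: (tau @: K) &, injective iota}
        & iota @: (~: (tau @: K)) = ~: (tau' @: (~: K))],
      [/\ {in K, forall i, sgn (tau i) = eps (+) odd i},
          {in ~: K, forall j, sgn (tau' j) = ~~ (eps (+) odd j)}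
        & {in ~: (tau @: K), forall v, sgn (iota v) = sgn v}],
      [/\ {in K &, forall i j, i != j ->
             @glue X (tau i, idx i j) = (tau j, idx j i)},
          {in ~: K &, forall i j, i != j ->
             @glue X' (tau' i, idx i j) = (tau' j, idx j i)}
        & forall F F', mp_corr K tau tau' iota F F' ->
             mp_corr K tau tau' iota (glue F) (glue F')]
    & [/\ {in K &, forall i j, i != j -> @fwt X (tau i, idx i j) = 0%R},
          {in ~: K &, forall i j, i != j ->
             @fwt X' (tau' i, idx i j) = w (~: [set i; j])}
        & forall F F', mp_corr K tau tau' iota F F' ->
             (fwt F' = fwt F + mp_outer K tau' w F'
                             + mp_outer K tau' w (glue F'))%R]].

(* K = {1, 3}, and eps = false makes all five tetrahedra positive. *)
Definition primary_mp_move (X X' : iograph) : Prop :=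
  mp_move false [set @Ordinal 5 1 isT; @Ordinal 5 3 isT] (fun _ => 0%R) X X'.

(* The pillow consists of the new tetrahedra ta and tb of G', in which x, y, p, q
   are the positions of x_0, y_0, p, q in their total order. *)
Record pillow (G G' : ograph) (iota : vertex G -> vertex G')
    (ta tb : vertex G') (x y p q : 'I_4) : Prop := {
  pillow_uniq : uniq [:: x; y; p; q];
  pillow_xy : x < y;
  pillow_low : ~~ ((p < x) && (q < x));
  pillow_high : ~~ ((y < p) && (y < q));
  pillow_inj : injective iota;
  pillow_new : ta != tb;
  pillow_old : iota @: [set: vertex G] = ~: [set ta; tb];
  pillow_sgn : forall v, sgn (iota v) = sgn v;
  pillow_sgn_new : sgn tb = ~~ sgn ta;
  pillow_ypq : @glue G' (ta, x) = (tb, x);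
  pillow_xpq : @glue G' (ta, y) = (tb, y) }.

(* Away from the cut, i.e. from the faces in the list s, nothing changes. *)
Definition unchanged_off (X X' : iograph) (iota : vertex X -> vertex X')
    (s : seq (vertex X * 'I_4)) : Prop :=
  forall F : vertex X * 'I_4, F \notin s ->
    @glue X' (push iota F) = push iota (@glue X F) /\
    @fwt X' (push iota F) = @fwt X F.

(* Conditions (i), (ii), (iii) for the weights z1, z2 of f_1, f_2, the sums
   u1, u2 of the weights of f_1', f_1'' and of f_2', f_2'', and those of X' on
   the triangles x_0pq = (ta, y) and y_0pq = (ta, x). *)
Definition slide_weights (X' : iograph) (ta tb : vertex X') (x y p q : 'I_4)
    (z1 z2 u1 u2 : int) : Prop :=
  [/\ forall s s' : 'I_4, (s, s') \in [:: (x, y); (y, x)] ->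
        (sigma s p s' * u1 + sigma s p q * @fwt X' (ta, s') =
           sigma s p s' * z1 + (dotted s p)%:Z)%R /\
        (sigma s q s' * u2 + sigma s q p * @fwt X' (ta, s') =
           sigma s q s' * z2 + (dotted s q)%:Z)%R,
      (sigma p q x * @fwt X' (ta, y) + sigma p q y * @fwt X' (ta, x) =
         -1 + (dotted p q)%:Z)%R
    & ((@delta X' (ta, x, y))%:~R = @euler X' (ta, x, y) :> rat)%R /\
      ((@delta X' (tb, x, y))%:~R = @euler X' (tb, x, y) :> rat)%R].

(* The pillow face x_0y_0p is opposite to q, and x_0y_0q is opposite to p.  The
   edge E' (resp. E'') is the edge xy of ta (resp. tb).

   It need not be said which sides of f_1 and f_2 face the same half of the
   neighbourhood of E: as gluings match out-ends with in-ends and ta, tb have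
   opposite signs, the only possible choice is the one in which ta fills the cut
   on one half and tb on the other.

   slide_distinct: f_1, f_2 are different triangles, with sides F1, glue F1 and
   F2, glue F2.

   slide_stack: f_1, f_2 are parallel copies of the triangle with sides F1 and
   glue F1, at the same or at different places around E; f_1 is the copy next
   to F1 and f_2 the copy next to glue F1.  After the move the two faces of
   the pillow on the inner sides of the stack (the face x_0y_0p of tb and a face
   x_0y_0q) face each other across two parallel triangles, which are merged; the
   weights of these are v1 and v2. *)
Inductive slide_move (X X' : iograph) : Prop :=
| slide_distinct (iota : vertex X -> vertex X') (ta tb : vertex X')
    (x y p q : 'I_4) (F1 F2 : vertex X * 'I_4) of
    @pillow X X' iota ta tb x y p q
  & F2 \notin [:: F1; @glue X F1]
  & same_edge (@fcorner X F1 (idx q x) (idx q y))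
              (@fcorner X F2 (idx p x) (idx p y))
  & unchanged_off iota [:: F1; @glue X F1; F2; @glue X F2]
  & @glue X' (push iota F1) = (ta, q)
  & @glue X' (push iota (@glue X F1)) = (tb, q)
  & @glue X' (push iota F2) = (ta, p)
  & @glue X' (push iota (@glue X F2)) = (tb, p)
  & @slide_weights X' ta tb x y p q (@fwt X F1) (@fwt X F2)
      (@fwt X' (ta, q) + @fwt X' (tb, q))%R
      (@fwt X' (ta, p) + @fwt X' (tb, p))%R
| slide_stack (iota : vertex X -> vertex X') (ta tb t t' : vertex X')
    (x y p q : 'I_4) (F1 : vertex X * 'I_4) (z1 z2 v1 v2 : int) of
    @pillow X X' iota ta tb x y p q
  & (t, t') \in [:: (ta, tb); (tb, ta)]
  & same_edge (@fcorner X F1 (idx q x) (idx q y))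
              (@fcorner X F1 (idx p x) (idx p y))
  & unchanged_off iota [:: F1; @glue X F1]
  & @glue X' (push iota F1) = (ta, q)
  & @glue X' (push iota (@glue X F1)) = (t, p)
  & @glue X' (tb, q) = (t', p)
  & @fwt X F1 = (z1 + z2)%R
  & @fwt X' (tb, q) = (v1 + v2)%R
  & @slide_weights X' ta tb x y p q z1 z2
      (@fwt X' (ta, q) + v1)%R (@fwt X' (t, p) + v2)%R.

Inductive elementary_move (X X' : iograph) : Prop :=
| by_iso of iso X X'
| by_primary_mp of primary_mp_move X X'
| by_slide of slide_move X X'
| by_hmove of hmove X X'.

Definition derivable : iograph -> iograph -> Prop :=
  clos_refl_sym_trans iograph elementary_move.

(* Main.v *)
(* Let D_0, .., D_4 be the tetrahedra of the boundary of the simplex 01234, and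
   {a, b, c, d, e} = {0, .., 4}. To replace D_a, D_b by D_c, D_d, D_e, slide
   first the two outer triangles ade and bde of D_a and D_b over the edge de:
   this inserts a pillow made of D_c, placed next to D_a and D_b, and of its
   mirror image. Now D_a, D_b, D_c surround the edge de, and an inverse MP move
   with K' = {d, e} replaces them by D_d, D_e; the mirror image of D_c is the
   third tetrahedron wanted. So the type (eps, {a, b}) follows from (~~ eps,
   {d, e}) whenever the pillow is allowed. The disjoint pairs concerned form
   the Petersen graph without the vertices 01 and 34, which is connected and
   contains 5-cycles, so all 16 types are reached from one.

   As for weights, functions on the triangles of the simplex are 2-chains,
   (delta w)(E) is the coefficient of the boundary of w at E, and an H-move
   adds the boundary of a tetrahedron. For two types as above the sum of the
   two functions w is, near the vertex c, the boundary of a 3-chain by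
   acyclicity; its coefficients tell which H-moves make the weights match, and
   its difference with w + w' on the faces of D_c is a solution of the
   equations of the sliding move. *)

Require Import Defs.
From mathcomp Require Import all_boot all_order all_algebra all_fingroup.
From mathcomp Require Import boolp reals.
From mathcomp Require Import zify ring lra.
From Stdlib Require Import Relation_Operators.

Set Implicit Arguments.
Unset Strict Implicit.
Unset Printing Implicit Defensive.
Import Order.TTheory GRing.Theory Num.Theory.

Local Open Scope nat_scope.

(** The obstacle is that outer triangles and edges of the bipyramid may be identified in the
    complex, so an equation at an edge of [X] is not an equation at an edge of the abstract simplex.
    The remedy is to split the weight of each triangle between its two sides. Coboundaries, H-moves
    and the values of [w] then become functions of the four faces of single tetrahedra, and the
    framing condition says that integer defects of corners add up to -2 around each edge. The
    equations (iii) of the sliding move are the only ones that involve tetrahedra outside the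
    bipyramid, and they are not computed. Framing is invariant under integral MP moves, so it passes
    from [X] to [X'], and from there to the o-graph [Y] produced by the slide, because [Y] is also
    the result of the MP move with [K' = {d, e}] applied to [X'] after H-moves. This is why each
    reduction carries [cframed], and why MP moves are treated as a relation between two subdivisions
    that can be read in either direction. *)

Ltac case_ord i :=
  let n := fresh "n" in let Hn := fresh "Hn" in
  case: i => n Hn; repeat (destruct n as [|n]; [|try by []]); try by [].

(** * Faces, triangles and half weights *)

Lemma over_out s o : over_face (out_face s o) = o.
Proof. by case: s; case: o. Qed.

Lemma over_in s o : over_face (in_face s o) = o.
Proof. by case: s; case: o. Qed.

Lemma out_faceE s (k : 'I_4) : (k == out_face s (over_face k)) = (s == odd k).
Proof. by case_ord k; case: s. Qed.

Lemma outgoingE (G : ograph) (F : face G) : outgoing F = (sgn F.1 == odd F.2).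
Proof. exact: out_faceE. Qed.

Lemma in_faceE s (k : 'I_4) : (k == in_face s (over_face k)) = (s != odd k).
Proof. by case_ord k; case: s. Qed.

Lemma outgoing_tri_out (G : ograph) (e : vertex G * bool) : outgoing (tri_out e).
Proof. by rewrite /outgoing /= over_out. Qed.

Lemma outgoing_tri_in (G : ograph) (e : vertex G * bool) :
  outgoing (tri_in e) = false.
Proof. by rewrite outgoingE /=; case: (sgn _); case: (_.2). Qed.

Lemma triangle_tri_out (G : ograph) (e : vertex G * bool) :
  triangle_of (tri_out e) = e.
Proof. by rewrite /triangle_of outgoing_tri_out /= over_out; case: e. Qed.

Lemma triangle_tri_in (G : ograph) (e : vertex G * bool) :
  triangle_of (tri_in e) = e.
Proof.
rewrite /triangle_of outgoing_tri_in /= over_in.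
by case E: (edge G e) => [v o] /=; rewrite -E permK.
Qed.

Lemma tri_outK (G : ograph) (F : face G) :
  outgoing F -> tri_out (triangle_of F) = F.
Proof.
move=> oF; rewrite /triangle_of oF; move: oF; rewrite /outgoing /tri_out.
by case: F => v k /= /eqP <-.
Qed.

Lemma tri_inK (G : ograph) (F : face G) :
  ~~ outgoing F -> tri_in (triangle_of F) = F.
Proof.
rewrite /triangle_of => oF; rewrite (negbTE oF) /tri_in permKV.
move: oF; rewrite outgoingE -in_faceE.
by case: F => v k /= /eqP <-.
Qed.

Lemma glue_tri_out (G : ograph) (e : vertex G * bool) :
  glue (tri_out e) = tri_in e.
Proof. by rewrite /glue outgoing_tri_out triangle_tri_out. Qed.

Lemma glue_tri_in (G : ograph) (e : vertex G * bool) :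
  glue (tri_in e) = tri_out e.
Proof. by rewrite /glue outgoing_tri_in triangle_tri_in. Qed.

Lemma outgoing_glue (G : ograph) (F : face G) : outgoing (glue F) = ~~ outgoing F.
Proof.
by rewrite /glue; case: (outgoing F); rewrite ?outgoing_tri_in ?outgoing_tri_out.
Qed.

Lemma glueK (G : ograph) : involutive (@glue G).
Proof.
move=> F; case oF: (outgoing F).
  by rewrite -(tri_outK oF) glue_tri_out glue_tri_in.
by rewrite -(tri_inK (negbT oF)) glue_tri_in glue_tri_out.
Qed.

Lemma triangle_glue (G : ograph) (F : face G) :
  triangle_of (glue F) = triangle_of F.
Proof.
by rewrite {1}/glue; case: ifP => _; rewrite ?triangle_tri_in ?triangle_tri_out.
Qed.

Lemma fwt_glue (X : iograph) (F : face X) : fwt (glue F) = fwt F.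
Proof. by rewrite /fwt triangle_glue. Qed.

(** The split is arbitrary: only the sum over the two sides is constrained. Once it is chosen, each
    tetrahedron carries its own four numbers, and identified triangles need no separate
    treatment. *)
Definition half (X : iograph) (h : vertex X * 'I_4 -> int) : Prop :=
  forall F : vertex X * 'I_4, @fwt X F = (h F + h (@glue X F))%R.

Lemma half_exists (X : iograph) : exists h : vertex X * 'I_4 -> int, half h.
Proof.
exists (fun F => if @outgoing X F then @fwt X F else 0%R) => F.
by rewrite outgoing_glue fwt_glue; case: (outgoing F) => /=; rewrite ?addr0 ?add0r.
Qed.

Lemma sum_faces (X : iograph) (A : vertex X * 'I_4 -> int) :
  (\sum_F A F = \sum_(e : vertex X * bool)
                  (A (@tri_out X e) + A (@tri_in X e)))%R.
Proof.
rewrite big_split /= (bigID (fun F => @outgoing X F)) /=; congr (_ + _)%R.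
  rewrite (reindex_onto (@tri_out X) (@triangle_of X)) /=; last exact: tri_outK.
  by apply: eq_bigl => e; rewrite outgoing_tri_out triangle_tri_out eqxx.
rewrite (reindex_onto (@tri_in X) (@triangle_of X)) /=; last exact: tri_inK.
by apply: eq_bigl => e; rewrite outgoing_tri_in triangle_tri_in eqxx.
Qed.

(** * Local form of the framing condition *)

Lemma sum_lift n (k : 'I_n.+1) (F : 'I_n.+1 -> int) :
  (\sum_(i | i != k) F i = \sum_(m < n) F (lift k m))%R.
Proof.
rewrite big_mkcond (bigD1_ord k) //= eqxx /= add0r.
by apply: eq_bigr => m _; rewrite eq_sym neq_lift.
Qed.

Lemma corner_adj_glue (G : ograph) (F : face G) m n :
  corner_adj (fcorner F m n) (fcorner (glue F) m n).
Proof.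
by apply/existsP; exists F; apply/existsP; exists m; apply/existsP; exists n;
  rewrite !eqxx.
Qed.

Lemma corner_adjP (G : ograph) (c c' : corner G) :
  reflect (exists F m n, c = fcorner F m n /\ c' = fcorner (glue F) m n)
          (corner_adj c c').
Proof.
apply: (iffP existsP) => [[F /existsP[m /existsP[n /andP[/eqP -> /eqP ->]]]]|].
  by exists F, m, n.
move=> [F [m [n [-> ->]]]]; exists F.
by apply/existsP; exists m; apply/existsP; exists n; rewrite !eqxx.
Qed.

Lemma corner_adj_sym (G : ograph) : symmetric (@corner_adj G).
Proof.
suff H c c' : @corner_adj G c c' -> corner_adj c' c.
  by move=> c c'; apply/idP/idP; apply: H.
move=> /corner_adjP [F [m [n [-> ->]]]].
by rewrite -{2}(glueK F); apply: corner_adj_glue.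
Qed.

Lemma same_edge_sym (G : ograph) : symmetric (@same_edge G).
Proof. by exact/sym_connect_sym/corner_adj_sym. Qed.

Lemma same_edge_trans (G : ograph) : transitive (@same_edge G).
Proof. exact: connect_trans. Qed.

Lemma same_edge_refl (G : ograph) : reflexive (@same_edge G).
Proof. exact: connect0. Qed.

Lemma same_edge_glue (G : ograph) (F : face G) m n :
  same_edge (fcorner F m n) (fcorner (glue F) m n).
Proof. exact/connect1/corner_adj_glue. Qed.

Lemma same_edge_congr (G : ograph) (c1 c2 : corner G) :
  same_edge c1 c2 -> forall c, same_edge c c1 = same_edge c c2.
Proof.
move=> h c; apply/idP/idP => h'; apply: (same_edge_trans h') => //.
by rewrite same_edge_sym.
Qed.

(* The third vertex of a face F_k containing the edge ij is 6 - i - j - k. *)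
Definition charge (V : finType) (h : V * 'I_4 -> int) (t : V) (i j : 'I_4) :
    int :=
  (\sum_(k | (k != i) && (k != j)) sigma i j (6 - i - j - k) * h (t, k))%R.

Lemma lt_lift n (k : 'I_n.+1) (i j : 'I_n) : (lift k i < lift k j) = (i < j).
Proof. by rewrite /= ltnNge leq_bump2 -ltnNge. Qed.

Lemma sigma_lift (k : 'I_4) (m n : 'I_3) :
  m < n ->
  sigma m n (3 - m - n) = sigma (lift k m) (lift k n) (6 - lift k m - lift k n - k).
Proof. by case_ord k; case_ord m; case_ord n. Qed.

Lemma sum_corners (V : finType) (f : V * 'I_4 * 'I_4 -> int) :
  (\sum_c f c = \sum_t \sum_i \sum_j f (t, i, j))%R.
Proof. by rewrite pair_bigA pair_bigA /=; apply: eq_bigr => -[[t i] j] _. Qed.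

(** Gluings preserve order, so the sign [sigma] and the edge class are the same seen from both sides
    of a triangle, and its weight can be distributed between them. Exchanging sums then collects the
    terms by corners. *)
Lemma delta_charge (X : iograph) (h : vertex X * 'I_4 -> int) (c : corner X) :
  half h ->
  delta c = (\sum_(c' : corner X | same_edge c c' && (c'.1.2 < c'.2)%N)
               charge h c'.1.1 c'.1.2 c'.2)%R.
Proof.
move=> hh.
pose A (F : vertex X * 'I_4) : int :=
  (\sum_(m < 3) \sum_(n < 3 | (m < n)%N && same_edge c (@fcorner X F m n))
     sigma m n (3 - m - n)%N)%R.
have A_glue e : A (@tri_in X e) = A (tri_out e).
  rewrite /A; apply: eq_bigr => m _; apply: eq_bigl => n.
  by rewrite -glue_tri_out -(same_edge_congr (same_edge_glue (tri_out e) m n)).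
transitivity (\sum_F A F * h F)%R.
  rewrite sum_faces /delta; apply: eq_bigr => e _.
  rewrite A_glue -mulrDr; have := hh (tri_out e).
  rewrite /fwt triangle_tri_out glue_tri_out => <-.
  rewrite /A big_distrl /=; apply: eq_bigr => m _.
  by rewrite big_distrl.
rewrite [RHS]big_mkcond [RHS]sum_corners.
transitivity (\sum_t \sum_k A (t, k) * h (t, k))%R.
  by rewrite pair_bigA; apply: eq_bigr => -[t k] _.
apply: eq_bigr => t _; rewrite /charge.
pose P (i j : 'I_4) := (i < j) && same_edge c (t, i, j).
transitivity (\sum_k \sum_(i | i != k) \sum_(j | j != k)
   if P i j then sigma i j (6 - i - j - k) * h (t, k) else 0)%R.
  apply: eq_bigr => k _; rewrite sum_lift /A big_distrl; apply: eq_bigr => m _ /=.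
  rewrite sum_lift big_distrl big_mkcond; apply: eq_bigr => n _ /=.
  have E := @sigma_lift k m n.
  rewrite /P lt_lift /fcorner; case: ifP => [/andP [mn _]|_].
    by rewrite (E mn).
  by [].
transitivity (\sum_k \sum_i \sum_j
  if [&& P i j, k != i & k != j]
  then sigma i j (6 - i - j - k) * h (t, k) else 0)%R.
  apply: eq_bigr => k _; rewrite big_mkcond; apply: eq_bigr => i _.
  rewrite (eq_sym i k); case: (k == i) => /=.
    by rewrite big1 // => j _; rewrite andbF.
  rewrite big_mkcond; apply: eq_bigr => j _.
  by rewrite (eq_sym j k); case: (k == j) => /=; rewrite !(andbT, andbF).
rewrite exchange_big /=; apply: eq_bigr => i _.
rewrite exchange_big /=; apply: eq_bigr => j _.
rewrite andbC -/(P i j); case: (P i j) => /=; last by rewrite big1.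
by rewrite -big_mkcond.
Qed.

(* Twice the local contribution of a corner to [delta - euler]. *)
Definition defect (V : finType) (h : V * 'I_4 -> int) (c : V * 'I_4 * 'I_4) :
    int :=
  (2 * charge h c.1.1 c.1.2 c.2 - (dotted c.1.2 c.2)%:Z)%R.

Definition cframed_at (X : iograph) (c : corner X) : Prop :=
  ((delta c)%:~R = euler c :> rat)%R.

Definition cframed (X : iograph) : Prop :=
  forall (t : vertex X) (i j : 'I_4), i < j -> @cframed_at X (t, i, j).

(** Doubling clears the denominator of the Euler cochain, so that later framing arguments stay in
    the integers, with target value -2. *)
Lemma half_euler (D : int) (N : nat) :
  (D%:~R = - (1 - N%:R / 2%:R) :> rat)%R <-> (2 * D - N%:Z = -2)%R.
Proof.
have E : ((2 * D - N%:Z + 2)%:~R = 2%:R * (D%:~R + (1 - N%:R / 2%:R)) :> rat)%R.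
  by rewrite !rmorphD rmorphM rmorphN /= -pmulrn; field.
have aux : (2 * D - N%:Z + 2 = 0)%R <-> (2 * D - N%:Z = -2)%R by lia.
split=> [h|/aux h].
  by apply/aux/eqP; rewrite -(intr_eq0 rat) E h addNr mulr0.
move: E; rewrite h => /esym/eqP; rewrite mulf_eq0 /= => /eqP E.
by apply/eqP; rewrite -subr_eq0 opprK; apply/eqP.
Qed.

Lemma cframed_atP (X : iograph) (h : vertex X * 'I_4 -> int) (c : corner X) :
  half h ->
  cframed_at c <->
  (\sum_(c' : corner X | same_edge c c' && (c'.1.2 < c'.2)%N) defect h c' = -2)%R.
Proof.
move=> hh; rewrite /cframed_at (delta_charge c hh) /defect sumrB -big_distrr /=.
set D := (\sum_(_ | _) charge _ _ _ _)%R.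
have -> : (\sum_(c' : corner X | same_edge c c' && (c'.1.2 < c'.2)%N)
   (dotted c'.1.2 c'.2)%:Z = (ndots c)%:Z)%R.
  rewrite /ndots -sum1_card -(big_morph _ PoszD (erefl 0%R)) big_mkcond /=.
  rewrite [in RHS]big_mkcond; congr Posz; apply: eq_bigr => c' _; rewrite inE.
  by case: same_edge; case: ltnP; case: dotted.
exact: half_euler.
Qed.

(** * H-moves *)

(* y v integral H-moves at every vertex v. *)
Definition hshift (X : iograph) (y : vertex X -> int) : iograph :=
  @Iograph (igraph X) (fun e => weight e + y (edge X e).1 - y e.1)%R.

Lemma hshift_hmove (X : iograph) (y y' : vertex X -> int) (v : vertex X) :
  (forall u, y' u = y u + (u == v)%:Z)%R -> hmove (hshift y) (hshift y').
Proof.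
move=> hy; exists v; exists id; split=> //; first exact: (Bijective (g := id)).
  by move=> u o /=; case: (edge X (u, o)).
by move=> u o /=; rewrite !hy; lia.
Qed.

(** Induction on the sum of the absolute values of [y]: one value is moved by one unit towards 0, by
    an H-move if it is positive and by an inverse H-move if it is negative. *)
Lemma derivable_hshift (X : iograph) (y : vertex X -> int) :
  derivable X (hshift y).
Proof.
move: {2}(\sum_v `|y v|%N) (leqnn (\sum_v `|y v|%N)) => n.
elim: n y => [|n IH] y.
  rewrite leqn0 sum_nat_eq0 => /forallP y0.
  have {}y0 v : y v = 0%R by apply/eqP; rewrite -absz_eq0; apply: (y0 v).
  apply: rst_step; apply: by_iso; exists id; split=> //.
  - exact: (Bijective (g := id)).
  - by move=> u o /=; case: (edge X (u, o)).
  - by move=> u o /=; rewrite !y0; lia.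
move=> hn; have [v yv|y0] := pickP (fun v => y v != 0%R); last first.
  apply: IH; rewrite big1 // => v _.
  by have /= := y0 v; case: eqP => // ->.
pose y' u := (if u == v then y v - Num.sg (y v) else y u)%R.
have lt_y' : \sum_u `|y' u|%N < \sum_u `|y u|%N.
  rewrite (bigD1 v) //= [X in _ < X](bigD1 v) //= -addSn leq_add //.
    by rewrite /y' eqxx; move: yv; case: (y v) => -[|k] //= _; lia.
  by rewrite leq_eqVlt; apply/orP; left; apply/eqP/eq_bigr => u /negbTE; rewrite /y' => ->.
apply: (rst_trans _ _ _ (hshift y')).
  by apply: IH; rewrite -ltnS; apply: leq_trans hn.
have [yv_gt0|yv_le0] := ltrP 0%R (y v).
  apply: rst_step; apply: by_hmove; apply: (@hshift_hmove _ _ _ v) => u.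
  by rewrite /y'; case: eqP => [->|_]; rewrite ?gtr0_sg //; lia.
apply/rst_sym/rst_step/by_hmove/(@hshift_hmove _ _ _ v) => u.
rewrite /y'; case: eqP => [->|_]; rewrite ?ltr0_sg //; try lia.
Qed.

Definition hsign (X : iograph) (F : vertex X * 'I_4) (z : int) : int :=
  if @outgoing X F then (- z)%R else z.

(** With half weights, an H-move touches only the four faces of one tetrahedron, even if some of
    them are glued to each other. *)
Lemma half_hshift (X : iograph) (y : vertex X -> int) (h : vertex X * 'I_4 -> int) :
  half h -> @half (hshift y) (fun F => h F + hsign F (y F.1))%R.
Proof.
move=> hh F.
have hF : @fwt (hshift y) F = (@fwt X F + hsign F (y F.1) + hsign (@glue X F) (y (@glue X F).1))%R.
  have hE (e : vertex X * bool) : @fwt (hshift y) (@tri_out X e) =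
      (@fwt X (@tri_out X e) + hsign (@tri_out X e) (y e.1)
       + hsign (@tri_in X e) (y (@tri_in X e).1))%R.
    rewrite /hsign outgoing_tri_out outgoing_tri_in.
    rewrite {1}/fwt [X in (weight X)](@triangle_tri_out X e) /=.
    by rewrite /fwt triangle_tri_out [RHS]addrAC.
  case oF: (@outgoing X F).
    by rewrite -(tri_outK oF) hE glue_tri_out.
  rewrite -(tri_inK (negbT oF)) glue_tri_in; set e := triangle_of F.
  have := hE e; rewrite -[LHS]fwt_glue -[in X in _ = X -> _](fwt_glue (@tri_out X e)).
  by rewrite !glue_tri_out => E; rewrite addrAC; exact: E.
by rewrite hF hh -addrA addrACA.
Qed.

(** An edge of a tetrahedron lies on just two of its faces, whose signed contributions cancel: the
    boundary of a boundary vanishes. *)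
Lemma charge_hshift (X : iograph) (y : vertex X -> int)
    (h : vertex X * 'I_4 -> int) t (i j : 'I_4) :
  i < j ->
  charge (fun F => h F + hsign F (y F.1))%R t i j = charge h t i j.
Proof.
move=> ij; rewrite /charge; under eq_bigr do rewrite mulrDr.
rewrite big_split /= -[RHS]addr0; congr (_ + _)%R.
under eq_bigr do rewrite /hsign outgoingE /=.
move: (y t) (sgn t) => z s; rewrite big_mkcond !big_ord_recl big_ord0 /=.
by move: ij; case_ord i; case_ord j; case: s; rewrite /sigma /=; lia.
Qed.

Lemma cframed_hshift (X : iograph) (y : vertex X -> int) :
  cframed X -> cframed (hshift y).
Proof.
move=> fX t i j ij.
have [h hh] := half_exists X.
have [_] := @cframed_atP (hshift y) _ (t, i, j) (half_hshift (y := y) hh); apply.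
have [/(_ (fX t i j ij)) <- _] := @cframed_atP X h (t, i, j) hh.
by apply: eq_bigr => c /andP [_ ?]; rewrite /defect charge_hshift.
Qed.

(** * Combinatorics of the 4-simplex *)

Lemma lift_idx n (k i : 'I_n.+2) : i != k -> lift k (idx k i) = i.
Proof.
rewrite /idx; case: unliftP => [j -> //|->]; by rewrite eqxx.
Qed.

Lemma idx_lift n (k : 'I_n.+2) (m : 'I_n.+1) : idx k (lift k m) = m.
Proof. by rewrite /idx liftK. Qed.

Lemma idxK n (k : 'I_n.+2) (m : 'I_n.+1) : exists2 i, i != k & m = idx k i.
Proof. by exists (lift k m); rewrite ?idx_lift // eq_sym neq_lift. Qed.

Lemma idx_eq n (k i j : 'I_n.+2) :
  i != k -> j != k -> (idx k i == idx k j) = (i == j).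
Proof.
move=> ik jk; apply/eqP/eqP => [e|-> //].
by rewrite -(lift_idx ik) e lift_idx.
Qed.

Lemma lt_idx n (k i j : 'I_n.+2) :
  i != k -> j != k -> (idx k i < idx k j) = (i < j).
Proof. by move=> ik jk; rewrite -(lt_lift k) !lift_idx. Qed.

Lemma val_idx n (k i : 'I_n.+2) : i != k -> idx k i = unbump k i :> nat.
Proof. by move=> ik; rewrite -[in RHS](lift_idx ik) /= bumpK. Qed.

Lemma sigma_sym a b c : sigma a b c = sigma b a c.
Proof. by rewrite /sigma minnC maxnC. Qed.

Lemma sigma_idx n (k i j l : 'I_n.+2) :
  i != k -> j != k -> l != k ->
  sigma (idx k i) (idx k j) (idx k l) = sigma i j l.
Proof.
move=> ik jk lk; wlog ij: i j ik jk / i <= j => [H|].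
  by case/orP: (leq_total i j) => /H; first exact; rewrite sigma_sym => ->; rewrite // sigma_sym.
have ij' : idx k i <= idx k j by rewrite leqNgt lt_idx // -leqNgt.
rewrite /sigma (minn_idPl ij') (maxn_idPr ij') (minn_idPl ij) (maxn_idPr ij).
by rewrite !lt_idx.
Qed.

(** The range consists of naturals instead of ['I_5], so that claims about [idx], rewritten with
    [unbump], are decided by evaluation. *)
Definition all5 (P : nat -> bool) : bool := all P (iota 0 5).

Lemma all5P (P : nat -> bool) : all5 P -> forall i : 'I_5, P i.
Proof. by move=> /allP H i; apply: H; rewrite mem_iota /= add0n. Qed.

Lemma uniq_map_ord n (s : seq 'I_n) : uniq s -> uniq (map (@nat_of_ord n) s).
Proof. by rewrite map_inj_uniq //; apply: val_inj. Qed.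

(** Both sides are the rank of [u] among the vertices other than [i] and [k]: [D_i] and [D_k] number
    the vertices of their common triangle alike. *)
Lemma idx_exchange (i k u : 'I_5) : i != k -> u != i -> u != k ->
  idx (idx i k) (idx i u) = idx (idx k i) (idx k u).
Proof.
move=> ik ui uk; apply: val_inj => /=; rewrite !val_idx ?idx_eq // 1?eq_sym //.
move: ik ui uk; rewrite -!val_eqE /=; move: i k u.
have H : all5 (fun i => all5 (fun k => all5 (fun u =>
  [==> i != k, u != i, u != k => unbump (unbump i k) (unbump i u) ==
       unbump (unbump k i) (unbump k u)]))) by [].
move=> i k u; have {}H := all5P (all5P (all5P H i) k) u; move: H.
by move=> /implyP H /H /implyP {}H /H /implyP {}H /H /eqP.
Qed.

(** The sign of the triangle opposite to [j] in the boundary of [D_i], when [D_i] is oriented by the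
    order of its vertices. *)
Definition sg5 (i j : 'I_5) : int := if odd (idx i j) then (-1)%R else 1%R.

Definition sgn5 (i j : nat) : int := if odd (unbump i j) then (-1)%R else 1%R.

Lemma sg5E (i j : 'I_5) : i != j -> sg5 i j = sgn5 i j.
Proof. by move=> ij; rewrite /sg5 val_idx // eq_sym. Qed.

Lemma sg5_sq (i j : 'I_5) : (sg5 i j * sg5 i j = 1)%R.
Proof. by rewrite /sg5; case: odd. Qed.

(** With [D_i] taken with sign [(-1)^i], the boundary of the simplex is a cycle, so the common
    triangle of [D_i] and [D_j] gets opposite signs from the two. *)
Lemma odd_idx (i j : 'I_5) : i != j ->
  odd i (+) odd (idx i j) = ~~ (odd j (+) odd (idx j i)).
Proof.
move=> ij; rewrite !val_idx // 1?eq_sym //; move: ij; rewrite -val_eqE /=.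
have H : all5 (fun i => all5 (fun j => (i != j) ==>
  (odd i (+) odd (unbump i j) == ~~ (odd j (+) odd (unbump j i))))) by [].
by have /implyP {}H := all5P (all5P H i) j; move=> /H /eqP.
Qed.

(* The signs for which the boundary of a boundary vanishes: i is a tetrahedron
   D_i and uv one of its edges, common to its faces opposite to x and to y. *)
Lemma sigma_sg5 (u v x y i : 'I_5) : uniq [:: u; v; x; y; i] ->
  (sigma u v x * sigma u v y = - (sg5 i x * sg5 i y))%R.
Proof.
move=> U; have [ix iy] : i != x /\ i != y.
  by split; apply/eqP => e; move: U; rewrite e /= !inE !eqxx !(orbT, andbF).
rewrite !sg5E //; move/uniq_map_ord: U => /=.
have H : all5 (fun u => all5 (fun v => all5 (fun x => all5 (fun y => all5 (fun i =>
  uniq [:: u; v; x; y; i] ==>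
  ((sigma u v x * sigma u v y)%R == (- (sgn5 i x * sgn5 i y))%R)))))).
  by vm_compute.
have /implyP {}H := all5P (all5P (all5P (all5P (all5P H u) v) x) y) i.
by move=> /H /eqP.
Qed.

Lemma mem_ord5 (s : seq 'I_5) (i : 'I_5) : uniq s -> size s = 5 -> i \in s.
Proof.
move=> Us ss; have sub : {subset s <= enum 'I_5} by move=> j _; rewrite mem_enum.
have [|_ ->] := uniq_min_size Us sub; last by rewrite mem_enum.
by rewrite ss size_enum_ord.
Qed.

(** A labelling of the five vertices in arbitrary order; one statement about it serves all positions
    of the labels in the total order. *)
Definition perm5 (a b c d e : 'I_5) : bool := uniq [:: a; b; c; d; e].

Lemma perm5P (a b c d e : 'I_5) : perm5 a b c d e ->
  forall i, [|| i == a, i == b, i == c, i == d | i == e].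
Proof. by move=> U i; have := mem_ord5 i U (erefl _); rewrite !inE. Qed.

Lemma perm5_perm (a b c d e a' b' c' d' e' : 'I_5) : perm5 a b c d e ->
  (forall p : pred 'I_5,
     count p [:: a'; b'; c'; d'; e'] = count p [:: a; b; c; d; e]) ->
  perm5 a' b' c' d' e'.
Proof. by move=> U H; rewrite /perm5 (@perm_uniq _ _ [:: a; b; c; d; e]) //; apply/seq.permP. Qed.

Ltac reperm H := by apply: (perm5_perm H) => p /=; clear; lia.

Lemma perm5_eqF (a b c d e : 'I_5) : perm5 a b c d e ->
  (((a == b) = false) * ((a == c) = false) * ((a == d) = false)
     * ((a == e) = false) * ((b == a) = false) * ((b == c) = false)
     * ((b == d) = false) * ((b == e) = false) * ((c == a) = false)
     * ((c == b) = false) * ((c == d) = false) * ((c == e) = false)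
     * ((d == a) = false) * ((d == b) = false) * ((d == c) = false)
     * ((d == e) = false) * ((e == a) = false) * ((e == b) = false)
     * ((e == c) = false) * ((e == d) = false))%type.
Proof.
rewrite /perm5 /= !inE !negb_or => /and5P[/and4P[ab ac ad ae] /and3P[bc bd be] /andP[cd ce] de _].
by do !split; apply: negbTE => //; rewrite eq_sym.
Qed.

Lemma perm5_ind (a b c d e : 'I_5) (P : 'I_5 -> Prop) : perm5 a b c d e ->
  P a -> P b -> P c -> P d -> P e -> forall i, P i.
Proof. by move=> U pa pb pc pd pe i; case/or4P: (perm5P U i) => [||| /orP[]] /eqP ->. Qed.

Lemma perm5_exists (u v : 'I_5) : u != v -> exists x y z, perm5 u v x y z.
Proof.
move=> uv; have Us : uniq [:: u; v] by rewrite /= inE uv.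
pose s := rem u (rem v (enum 'I_5)).
have Uv : uniq (rem v (enum 'I_5)) by rewrite rem_uniq // enum_uniq.
have us : u \in rem v (enum 'I_5) by rewrite mem_rem_uniq ?enum_uniq // !inE uv mem_enum.
have ss : size s = 3 by rewrite /s (size_rem us) size_rem ?mem_enum // size_enum_ord.
have Us' : uniq s by rewrite rem_uniq.
have : forall x, x \in s -> (x != u) && (x != v).
  by move=> x; rewrite (mem_rem_uniq _ Uv) inE mem_rem_uniq ?enum_uniq // inE => /and3P[-> ->].
case: s ss Us' => [|x [|y [|z []]]] // _; rewrite /= !inE !negb_or andbT.
move=> /andP[/andP[xy xz] yz] H; exists x, y, z.
have /andP[xu xv] : (x != u) && (x != v) by apply: H; rewrite !inE eqxx.
have /andP[yu yv] : (y != u) && (y != v) by apply: H; rewrite !inE eqxx orbT.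
have /andP[zu zv] : (z != u) && (z != v) by apply: H; rewrite !inE eqxx !orbT.
by rewrite /perm5 /= !inE !negb_or uv xy xz yz ![u == _]eq_sym ![v == _]eq_sym xu xv yu yv zu zv.
Qed.

(** * 2-chains of the 4-simplex and the equations for [w] *)

Lemma setC_perm5 (a b c d e : 'I_5) : perm5 a b c d e ->
  [set a; b; c] = ~: [set d; e].
Proof.
move=> U; apply/setP; apply: (perm5_ind U);
  by rewrite !inE !eqxx ?(perm5_eqF U).
Qed.

(* The triangles are indexed by the complementary pairs ij; the triangle ~: K,
   ignored by [mp_admissible], gets the value 0. *)
Definition opp_val (K : {set 'I_5}) (w : {set 'I_5} -> int) (i j : 'I_5) : int :=
  if [set i; j] == K then 0%R else w (~: [set i; j]).

Lemma opp_val_sym K w i j : opp_val K w i j = opp_val K w j i.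
Proof. by rewrite /opp_val setUC. Qed.

(* The coefficient at uv of the boundary of the 2-chain W; it is meant for
   distinct u, v, x, y, z. *)
Definition cobd (W : 'I_5 -> 'I_5 -> int) (u v x y z : 'I_5) : int :=
  (sigma u v x * W y z + sigma u v y * W x z + sigma u v z * W x y)%R.

Definition dots (i u v : 'I_5) : int := dotted (idx i u) (idx i v).

Lemma dottedC (m n : 'I_4) : dotted m n = dotted n m.
Proof. by case_ord m; case_ord n. Qed.

Lemma dotsC i u v : dots i u v = dots i v u.
Proof. by rewrite /dots dottedC. Qed.

Lemma mp_coboundaryE K w (u v x y z : 'I_5) : perm5 u v x y z ->
  mp_coboundary K w u v = cobd (opp_val K w) u v x y z.
Proof.
move=> U; rewrite /mp_coboundary.
have Ei : forall i, [&& i != u, i != v & [set u; v; i] != ~: K] =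
    (i \in [:: x; y; z]) && ([set u; v; i] != ~: K).
  by apply: (perm5_ind U); rewrite !inE !eqxx ?(perm5_eqF U).
rewrite (eq_bigl _ _ Ei) big_mkcondr /= -big_uniq /=; last by move: U => /and3P[].
rewrite !big_cons big_nil /cobd addr0 -addrA /opp_val.
have E1 : [set u; v; x] = ~: [set y; z] by apply: setC_perm5; reperm U.
have E2 : [set u; v; y] = ~: [set x; z] by apply: setC_perm5; reperm U.
have E3 : [set u; v; z] = ~: [set x; y] by apply: setC_perm5; reperm U.
rewrite E1 E2 E3 !(inj_eq (@setC_inj _)).
have E (b : bool) (s t : int) : ((if ~~ b then s * t else 0) = s * (if b then 0 else t))%R.
  by case: b; rewrite ?mulr0.
by rewrite !E.
Qed.

Lemma mp_dotsE S (u v x y z : 'I_5) : perm5 u v x y z ->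
  ((mp_dots S u v)%:Z = (if x \in S then dots x u v else 0) +
     (if y \in S then dots y u v else 0) + (if z \in S then dots z u v else 0))%R.
Proof.
move=> U; rewrite /mp_dots.
have -> : [set i in S | [&& i != u, i != v & dotted (idx i u) (idx i v)]] =
   [set i in [:: x; y; z] | (i \in S) && dotted (idx i u) (idx i v)].
  by apply/setP; apply: (perm5_ind U); rewrite !inE !eqxx ?(perm5_eqF U) ?andbF.
rewrite -sum1_card big_mkcond /=.
rewrite (eq_bigr (fun i => if i \in [:: x; y; z] then
   ((i \in S) && dotted (idx i u) (idx i v) : nat) else 0)); last first.
  by move=> i _; rewrite !inE; case: (_ || _) => //=; case: (_ && _).
rewrite -big_mkcond -big_uniq /=; last by move: U => /and3P[].
rewrite !big_cons big_nil addn0 /dots !PoszD addrA.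
by case: (x \in S); case: (y \in S); case: (z \in S).
Qed.

(** Doubling merges the two cases of [mp_admissible]. Tetrahedra of [K] disappear and count
    negatively; if [uv] is the new edge, none of [x], [y], [z] is in [K], and only the Euler term -2
    is special. *)
Lemma mp_admissible2 K w (u v x y z : 'I_5) : mp_admissible K w ->
  perm5 u v x y z ->
  (2 * cobd (opp_val K w) u v x y z =
     (if x \in K then - dots x u v else dots x u v)
   + (if y \in K then - dots y u v else dots y u v)
   + (if z \in K then - dots z u v else dots z u v)
   - (if [set u; v] == K then 2 else 0))%R.
Proof.
move=> adm U; wlog uv: u v U / u < v => [H|].
  have [uv|vu|/val_inj e] := ltngtP u v; first exact: H.
    have U' : perm5 v u x y z by reperm U.
    have := H v u U' vu; rewrite /cobd ![sigma v u _]sigma_sym !(dotsC _ v u).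
    by rewrite [X in (X == K)]setUC.
  by move: U; rewrite e /perm5 /= inE eqxx.
have := adm u v uv; rewrite (mp_coboundaryE K w U).
set C := cobd _ _ _ _ _ _.
have := mp_dotsE K U; have := mp_dotsE (~: K) U; rewrite !inE.
set D' := mp_dots _ _ _; set D := mp_dots _ _ _ => eD' eD.
case: ifP => [/eqP KE|_] e.
  have e' : (2 * C - D'%:Z = -2)%R.
    by apply/half_euler; rewrite e; field.
  rewrite -KE !inE !(perm5_eqF U) /= in eD' *; lia.
have {}e : (2 * C = D'%:Z - D%:Z)%R.
  by apply/eqP; rewrite -(eqr_int rat) rmorphM rmorphB /= e -!pmulrn; apply/eqP; field=> /=.
rewrite e eD eD'; case: (x \in K); case: (y \in K); case: (z \in K) => /=; lia.
Qed.

(** Among the three triangles at the edge [ck], only [cka] contains [a]. The equation at [ck]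
    therefore expresses its value through two faces of [D_a], with the signs of a cone. *)
Lemma opp_val_cone (W : 'I_5 -> 'I_5 -> int) (a i j c k : 'I_5) :
  (forall i j, W i j = W j i) ->
  perm5 c k a i j -> cobd W c k a i j = 0%R ->
  (W i j = W a i * sg5 i a * sg5 i j + W a j * sg5 j a * sg5 j i)%R.
Proof.
move=> Ws U; rewrite /cobd => C.
have E1 := @sigma_sg5 c k a j i.
have E2 := @sigma_sg5 c k a i j.
have {}E1 : (sigma c k a * sigma c k j = - (sg5 i a * sg5 i j))%R by apply: E1; reperm U.
have {}E2 : (sigma c k a * sigma c k i = - (sg5 j a * sg5 j i))%R by apply: E2; reperm U.
have E3 : (sigma c k a * sigma c k a = 1)%R by rewrite /sigma; case: ifP.
rewrite -!mulrA; move: C E1 E2 E3.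
set s := sigma c k a; set si := sigma c k i; set sj := sigma c k j => C E1 E2 E3.
(* Multiplying by [s], whose square is 1, turns the [sigma] signs into products to which [sigma_sg5]
   applies. *)
have : (s * (s * W i j + si * W a j + sj * W a i) = 0)%R by rewrite C mulr0.
rewrite !mulrDr !mulrA E1 E2 E3.
lia.
Qed.

(** * MP moves preserve the framing condition *)

(** Outside the bipyramid the map [iota] of [mp_corr] is replaced by a relation, so that exchanging
    the two subdivisions is a symmetry. *)
Definition fcorr (S : {set 'I_5}) (X X' : ograph) (tau : 'I_5 -> vertex X)
    (tau' : 'I_5 -> vertex X') (O : vertex X -> vertex X' -> Prop)
    (F : face X) (F' : face X') : Prop :=
  (O F.1 F'.1 /\ F.2 = F'.2) \/
  (exists i j : 'I_5, [/\ i \in S, j \notin S,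
                          F = (tau i, idx i j) & F' = (tau' j, idx j i)]).

(* The part of [mp_move] which is symmetric in the two subdivisions of the
   bipyramid; O is the correspondence of the tetrahedra outside. *)
Record flip (S : {set 'I_5}) (X X' : ograph) (tau : 'I_5 -> vertex X)
    (tau' : 'I_5 -> vertex X') (O : vertex X -> vertex X' -> Prop) : Prop := {
  flip_inj : {in S &, injective tau};
  flip_inj' : {in ~: S &, injective tau'};
  flip_notin : forall v v', O v v' -> v \notin tau @: S;
  flip_notin' : forall v v', O v v' -> v' \notin tau' @: (~: S);
  flip_total : forall v, v \notin tau @: S -> exists v', O v v';
  flip_total' : forall v', v' \notin tau' @: (~: S) -> exists v, O v v';
  flip_fun : forall v v1 v2, O v v1 -> O v v2 -> v1 = v2;
  flip_fun' : forall v1 v2 v', O v1 v' -> O v2 v' -> v1 = v2;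
  flip_glue : {in S &, forall i j, i != j ->
    @glue X (tau i, idx i j) = (tau j, idx j i)};
  flip_glue' : {in ~: S &, forall i j, i != j ->
    @glue X' (tau' i, idx i j) = (tau' j, idx j i)};
  flip_corr : forall F F', fcorr S tau tau' O F F' ->
    fcorr S tau tau' O (glue F) (glue F') }.

Lemma fcorr_sym S (X X' : ograph) (tau : 'I_5 -> vertex X)
    (tau' : 'I_5 -> vertex X') (O : vertex X -> vertex X' -> Prop) F F' :
  fcorr S tau tau' O F F' <-> fcorr (~: S) tau' tau (fun v' v => O v v') F' F.
Proof.
split=> -[[o e]|[i [j [iS jS e e']]]]; [by left|right|by left|right];
  by exists j, i; move: iS jS; rewrite !inE ?negbK.
Qed.

Lemma flip_sym S (X X' : ograph) (tau : 'I_5 -> vertex X)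
    (tau' : 'I_5 -> vertex X') (O : vertex X -> vertex X' -> Prop) :
  flip S tau tau' O -> flip (~: S) tau' tau (fun v' v => O v v').
Proof.
case=> i1 i2 n1 n2 t1 t2 f1 f2 g1 g2 c; split; rewrite ?setCK => //.
- by move=> v v'; apply: n2.
- by move=> v v'; apply: n1.
- by move=> v v1 v2; apply: f2.
- by move=> v1 v2 v; apply: f1.
- move=> F F' H; have [H1 _] := fcorr_sym S tau tau' O (glue F') (glue F).
  by apply/H1/c; have [_] := fcorr_sym S tau tau' O F' F; apply.
Qed.

(** A corner of an old tetrahedron may correspond to corners of several new ones that share the edge
    [uv]; this is a relation, single-valued only on edge classes. *)
Definition cor (S : {set 'I_5}) (X X' : ograph) (tau : 'I_5 -> vertex X)
    (tau' : 'I_5 -> vertex X') (O : vertex X -> vertex X' -> Prop)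
    (c : corner X) (c' : corner X') : Prop :=
  (O c.1.1 c'.1.1 /\ (c.1.2 = c'.1.2 /\ c.2 = c'.2)) \/
  (exists i j u v : 'I_5, [/\ i \in S, j \notin S,
     [/\ u != i, u != j, v != i & v != j],
     c = (tau i, idx i u, idx i v) & c' = (tau' j, idx j u, idx j v)]).

Lemma fcorner_idx (G : ograph) (t : vertex G) (i k : 'I_5) (m n : 'I_3) :
  i != k -> exists u v,
  [/\ [/\ u != i, u != k, v != i & v != k],
      @fcorner G (t, idx i k) m n = (t, idx i u, idx i v)
    & forall (G' : ograph) (t' : vertex G'),
        @fcorner G' (t', idx k i) m n = (t', idx k u, idx k v)].
Proof.
move=> ik; have ki : k != i by rewrite eq_sym.
have H (r : 'I_3) : exists u, [/\ u != i, u != k, lift (idx i k) r = idx i u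
    & lift (idx k i) r = idx k u].
  have [m' m'k ->] := idxK (idx i k) r; have [u ui em] := idxK i m'.
  rewrite em in m'k *; rewrite idx_eq // in m'k.
  exists u; split=> //; first by rewrite lift_idx // idx_eq.
  by rewrite idx_exchange // lift_idx // idx_eq.
have [u [ui uk eu eu']] := H m; have [v [vi vk ev ev']] := H n.
by exists u, v; split=> // [|G' t']; rewrite /fcorner /= ?eu ?ev ?eu' ?ev'.
Qed.

Lemma fcorner_glue_idx (G : ograph) (t t' : vertex G) (i k u v : 'I_5) :
  i != k -> u != i -> u != k -> v != i -> v != k ->
  @glue G (t, idx i k) = (t', idx k i) ->
  same_edge ((t, idx i u, idx i v) : corner G) (t', idx k u, idx k v).
Proof.
move=> ik ui uk vi vk g; have ki : k != i by rewrite eq_sym.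
have := same_edge_glue (t, idx i k) (idx (idx i k) (idx i u)) (idx (idx i k) (idx i v)).
rewrite g /fcorner /= !lift_idx ?idx_eq //.
by rewrite !(idx_exchange (i := i)) // !lift_idx ?idx_eq.
Qed.

Lemma cor_face S (X X' : ograph) (tau : 'I_5 -> vertex X)
    (tau' : 'I_5 -> vertex X') (O : vertex X -> vertex X' -> Prop) F F' m n :
  fcorr S tau tau' O F F' -> cor S tau tau' O (fcorner F m n) (fcorner F' m n).
Proof.
case=> [[o e]|[i [j [iS jS -> ->]]]].
  by left; rewrite /fcorner /= e.
have ij : i != j by apply: contraNneq jS => <-.
have [u [v [ne -> ->]]] := fcorner_idx (tau i) m n ij.
by right; exists i, j, u, v.
Qed.

(** A path of corners around an edge is followed on the other side of the flip: crossing a face with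
    a counterpart is copied there, and crossing an inner triangle of the old subdivision needs no
    motion at all. *)
Lemma cor_same_edge S (X X' : ograph) (tau : 'I_5 -> vertex X)
    (tau' : 'I_5 -> vertex X') (O : vertex X -> vertex X' -> Prop) :
  flip S tau tau' O -> forall c c' d d', cor S tau tau' O c c' ->
  same_edge c d -> cor S tau tau' O d d' -> same_edge c' d'.
Proof.
move=> fl.
(* Two counterparts of one corner lie in new tetrahedra that are adjacent across an inner triangle
   containing [uv]. *)
have cor_fun c c1 c2 : cor S tau tau' O c c1 -> cor S tau tau' O c c2 ->
    same_edge c1 c2.
  case=> [[o1 [e1 e1']]|[i [j [u [v [iS jS [ui uj vi vj] e1 e2]]]]]].
  - case=> [[o2 [e2 e2']]|[i [j [u [v [iS jS _ e2 _]]]]]]; last first.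
      by move: (flip_notin fl o1); rewrite e2 /= imset_f.
    case: c c1 c2 o1 o2 e1 e1' e2 e2' => [[t p] q] [[t1 p1] q1] [[t2 p2] q2] /= o1 o2.
    by move=> <- <- <- <-; rewrite (flip_fun fl o1 o2) same_edge_refl.
  - case=> [[o2 [e3 e4]]|[i' [j' [u' [v' [iS' jS' [ui' uj' vi' vj'] e3 e4]]]]]].
      by move: (flip_notin fl o2); rewrite e1 /= imset_f.
    move: e3; rewrite e1 => -[] /(flip_inj fl iS iS') ei; rewrite -{}ei in ui' vi' *.
    move=> /eqP; rewrite idx_eq // => /eqP eu /eqP; rewrite idx_eq // => /eqP ev.
    rewrite -eu -ev in uj' vj' e4; rewrite e2 e4.
    have [<-|jj'] := eqVneq j j'; first exact: same_edge_refl.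
    by apply: fcorner_glue_idx => //; apply: (flip_glue' fl); rewrite ?inE.
have step c d c' : corner_adj c d -> cor S tau tau' O c c' ->
    exists2 d', cor S tau tau' O d d' & same_edge c' d'.
  move=> /corner_adjP [F [m [n [-> ->]]]] cc'.
  have [[F' FF']|[i [j [iS jS ij eF]]]] : (exists F', fcorr S tau tau' O F F') \/
      exists i j, [/\ i \in S, j \in S, i != j & F = (tau i, idx i j)].
    have [/imsetP [i iS eF]|/(flip_total fl) [v' o]] := boolP (F.1 \in tau @: S).
      have [j ji ej] := idxK i F.2.
      have eF' : F = (tau i, idx i j) by case: F eF ej {cc'} => t k /= -> ->.
      have [jS|jS] := boolP (j \in S); last by left; exists (tau' j, idx j i); right; exists i, j.
      by right; exists i, j; rewrite eq_sym.
    by left; exists (v', F.2); left.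
  - have cc'' := cor_face m n FF'; have dd'' := cor_face m n (flip_corr fl FF').
    exists (fcorner (glue F') m n) => //.
    exact: same_edge_trans (cor_fun _ _ _ cc' cc'') (same_edge_glue _ _ _).
  (* Across an inner triangle, both corners are at the same edge [uv] of the simplex, so [c'] stays
     a counterpart. *)
  - exists c'; last exact: same_edge_refl.
    rewrite eF (flip_glue fl iS jS ij).
    have [u [v [[ui uj vi vj] e1 e2]]] := fcorner_idx (tau i) m n ij.
    rewrite e2; move: cc'; rewrite eF e1.
    case=> [[o _]|[i' [j' [u' [v' [iS' jS' [ui' uj' vi' vj'] e3 e4]]]]]].
      by move: (flip_notin fl o); rewrite /= imset_f.
    move: e3 => -[] /(flip_inj fl iS iS') ei; rewrite -{}ei in ui' vi' *.
    move=> /eqP; rewrite idx_eq // => /eqP eu /eqP; rewrite idx_eq // => /eqP ev.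
    rewrite -eu -ev in uj' vj' e4.
    by right; exists j, j', u, v.
move=> c c' d d' cc' /connectP [p]; elim: p c c' cc' => [|c1 p IH] c c' cc' /=.
  by move=> _ -> dd'; apply: cor_fun cc' dd'.
move=> /andP[a pp] e dd'; have [c1' cc1 s] := step _ _ _ a cc'.
exact: same_edge_trans s (IH _ _ cc1 pp e dd').
Qed.

(** * Sums over corners, split along the bipyramid *)

Lemma sum_perm5 (S : {set 'I_5}) (u v x y z : 'I_5) (f : 'I_5 -> int) :
  perm5 u v x y z ->
  (\sum_(i in S | (i != u) && (i != v)) f i =
     (if x \in S then f x else 0) + (if y \in S then f y else 0)
     + (if z \in S then f z else 0))%R.
Proof.
move=> U; rewrite big_mkcondl /=.
have E : (fun i => (i != u) && (i != v)) =1 mem [:: x; y; z].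
  by apply: (perm5_ind U); rewrite !inE !eqxx ?(perm5_eqF U).
rewrite (eq_bigl _ _ E) -big_uniq /=; last by move: U => /and3P[].
by rewrite !big_cons big_nil addr0 addrA.
Qed.

(** Corners inside the bipyramid are regrouped by the edges [uv] of the simplex, since changes of
    defects are controlled edge by edge. *)
Lemma sum_flip (V : finType) (S : {set 'I_5}) (tau : 'I_5 -> V)
    (f : V * 'I_4 * 'I_4 -> int) : {in S &, injective tau} ->
  (\sum_(c : V * 'I_4 * 'I_4 | (c.1.2 < c.2)%N) f c =
     \sum_(t | t \notin tau @: S) \sum_(i : 'I_4) \sum_(j : 'I_4 | (i < j)%N) f (t, i, j)
   + \sum_(u : 'I_5) \sum_(v : 'I_5 | (u < v)%N)
       \sum_(i in S | (i != u) && (i != v)) f (tau i, idx i u, idx i v))%R.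
Proof.
move=> inj; rewrite big_mkcond sum_corners (bigID (fun t => t \in tau @: S)) /= addrC.
congr (_ + _)%R.
  by apply: eq_bigr => t _; apply: eq_bigr => i _; rewrite [RHS]big_mkcond.
rewrite big_imset //=.
transitivity (\sum_(s in S) \sum_(u : 'I_5 | u != s) \sum_(v : 'I_5 | v != s)
   if (u < v)%N then f (tau s, idx s u, idx s v) else 0)%R.
  apply: eq_bigr => s _; rewrite sum_lift; apply: eq_bigr => m _.
  rewrite sum_lift; apply: eq_bigr => n _.
  by rewrite lt_lift !idx_lift.
transitivity (\sum_(s in S) \sum_(u : 'I_5) \sum_(v : 'I_5)
   if [&& (u < v)%N, s != u & s != v] then f (tau s, idx s u, idx s v) else 0)%R.
  apply: eq_bigr => s _; rewrite big_mkcond; apply: eq_bigr => u _.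
  rewrite (eq_sym u s); case: (s == u) => /=.
    by rewrite big1 // => v _; rewrite andbF.
  rewrite big_mkcond; apply: eq_bigr => v _.
  by rewrite (eq_sym v s); case: (s == v) => /=; rewrite ?andbT ?andbF.
rewrite exchange_big /=; apply: eq_bigr => u _.
rewrite exchange_big /= [RHS]big_mkcond /=; apply: eq_bigr => v _.
case: ltnP => _ /=; last by rewrite big1.
by rewrite [RHS]big_mkcondr.
Qed.

Lemma sum_idx (u v i x y : 'I_5) : perm5 u v i x y ->
  (6 - idx i u - idx i v - idx i x = idx i y)%N.
Proof.
move=> U; rewrite !val_idx ?(perm5_eqF U) //; move/uniq_map_ord: U => /=.
have H : all5 (fun u => all5 (fun v => all5 (fun i => all5 (fun x => all5 (fun y =>
  uniq [:: u; v; i; x; y] ==>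
  (6 - unbump i u - unbump i v - unbump i x == unbump i y)))))).
  by vm_compute.
have /implyP {}H := all5P (all5P (all5P (all5P (all5P H u) v) i) x) y.
by move=> /H /eqP.
Qed.

Lemma charge_idx (V : finType) (h : V * 'I_4 -> int) (t : V) (u v i x y : 'I_5) :
  perm5 u v i x y ->
  (charge h t (idx i u) (idx i v) =
     sigma u v y * h (t, idx i x) + sigma u v x * h (t, idx i y))%R.
Proof.
move=> U; rewrite /charge.
have E k : (k != idx i u) && (k != idx i v) = (k \in [:: idx i x; idx i y]).
  have [z zi ->] := idxK i k; rewrite !inE !idx_eq ?(perm5_eqF U) //.
  move: z zi; apply: (perm5_ind U); rewrite ?eqxx ?(perm5_eqF U) //.
rewrite (eq_bigl _ _ E) -big_uniq /=; last first.
  by rewrite inE idx_eq ?(perm5_eqF U).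
rewrite !big_cons big_nil addr0.
have U' : perm5 u v i y x by reperm U.
by rewrite (sum_idx U) (sum_idx U') !sigma_idx ?(perm5_eqF U).
Qed.

Lemma fcorr_inj S (X X' : ograph) (tau : 'I_5 -> vertex X)
    (tau' : 'I_5 -> vertex X') (O : vertex X -> vertex X' -> Prop) :
  flip S tau tau' O -> forall F1 F2 F', fcorr S tau tau' O F1 F' ->
  fcorr S tau tau' O F2 F' -> F1 = F2.
Proof.
move=> fl [t1 k1] [t2 k2] F' [[o1 /= e1]|[i [j [iS jS -> e]]]].
  case=> [[o2 /= e2]|[i' [j' [iS' jS' -> e']]]].
    by have /= -> := flip_fun' fl o1 o2; rewrite e1 e2.
  by move: (flip_notin' fl o1); rewrite e' /= imset_f ?inE.
case=> [[o2 /= e2]|[i' [j' [iS' jS' -> e']]]].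
  by move: (flip_notin' fl o2); rewrite e /= imset_f ?inE.
have m : j \in ~: S by rewrite inE.
have m' : j' \in ~: S by rewrite inE.
move: e'; rewrite e => -[] /(flip_inj' fl m m') ej; rewrite -{}ej in jS' *.
have ij : i != j by apply: contraNneq jS => <-.
have ij' : i' != j by apply: contraNneq jS' => <-.
by move=> /eqP; rewrite idx_eq // => /eqP ->.
Qed.

Lemma fcorr_inner S (X X' : ograph) (tau : 'I_5 -> vertex X)
    (tau' : 'I_5 -> vertex X') (O : vertex X -> vertex X' -> Prop) :
  flip S tau tau' O -> forall F i j, i \notin S -> j \notin S -> i != j ->
  ~ fcorr S tau tau' O F (tau' i, idx i j).
Proof.
move=> fl F i j iS jS ij [[o _]|[i' [j' [iS' jS' _]]]].
  by move: (flip_notin' fl o); rewrite /= imset_f ?inE.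
have m : i \in ~: S by rewrite inE.
have m' : j' \in ~: S by rewrite inE.
move=> -[] /(flip_inj' fl m m') ej; rewrite -{}ej in jS' *.
have ij' : i' != i by apply: contraNneq iS => <-.
have ji : j != i by rewrite eq_sym.
by move=> /eqP; rewrite idx_eq // => /eqP e; rewrite e iS' in jS.
Qed.

Lemma mp_outer_in K (X' : iograph) (tau' : 'I_5 -> vertex X')
    (w : {set 'I_5} -> int) (i j : 'I_5) :
  {in ~: K &, injective tau'} -> i \in K -> j \notin K ->
  mp_outer K tau' w (tau' j, idx j i) = w (~: [set i; j]).
Proof.
move=> inj iK jK.
have ne i0 j0 : i0 \in K -> j0 \notin K -> i0 != j0.
  by move=> h; apply: contraNneq => <-.
have E i0 j0 : i0 \in K -> j0 \notin K ->
    ((tau' j, idx j i) == (tau' j0, idx j0 i0)) = (j0 == j) && (i0 == i).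
  move=> iK0 jK0; apply/eqP/andP => [|[/eqP -> /eqP ->] //].
  have m : j \in ~: K by rewrite inE.
  have m' : j0 \in ~: K by rewrite inE.
  move=> -[] /(inj _ _ m m') ej; rewrite -{}ej in jK0 *; move/eqP.
  by rewrite idx_eq ?ne // eq_sym eqxx.
rewrite /mp_outer (bigD1 i) //= [X in (_ + X)%R]big1 ?addr0 => [|i0 /andP[iK0 n]].
  rewrite (big_pred1 j) // => j0; rewrite inE /=.
  have [->|jj] := eqVneq j0 j; first by rewrite jK eqxx.
  by case jK0: (j0 \in K) => //=; rewrite E ?jK0 // (negbTE jj).
by rewrite big_pred0 // => j0; rewrite inE; case jK0: (j0 \in K) => //=;
  rewrite E ?jK0 // (negbTE n) andbF.
Qed.

Lemma mp_outer_notin K (X' : iograph) (tau' : 'I_5 -> vertex X')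
    (w : {set 'I_5} -> int) v k :
  v \notin tau' @: (~: K) -> mp_outer K tau' w (v, k) = 0%R.
Proof.
move=> vK; rewrite /mp_outer big1 // => i iK; rewrite big_pred0 // => j.
rewrite xpair_eqE; apply/negbTE; apply: contra vK => /and3P[jK /eqP -> _].
exact: imset_f.
Qed.

(** * Half weights across an MP move *)

Definition outside (K : {set 'I_5}) (X X' : ograph) (tau : 'I_5 -> vertex X)
    (iota : vertex X -> vertex X') (v : vertex X) (v' : vertex X') : Prop :=
  v \notin tau @: K /\ v' = iota v.

Lemma mp_corrE K (X X' : iograph) (tau : 'I_5 -> vertex X)
    (tau' : 'I_5 -> vertex X') (iota : vertex X -> vertex X') F F' :
  mp_corr K tau tau' iota F F' <-> fcorr K tau tau' (outside K tau iota) F F'.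
Proof.
split=> -[[H1 H2]|H]; [left|by right|left|by right].
  by rewrite H2; split.
by case: F F' H1 H2 => [t k] [t' k'] /= [H ->] ->; split.
Qed.

(* Half weights h, h' for which an MP move changes h only by adding w, on the
   inner sides of the outer triangles of the bipyramid. *)
Record mp_weights (K : {set 'I_5}) (w : {set 'I_5} -> int) (X X' : iograph)
    (tau : 'I_5 -> vertex X) (tau' : 'I_5 -> vertex X')
    (O : vertex X -> vertex X' -> Prop) (h : vertex X * 'I_4 -> int)
    (h' : vertex X' * 'I_4 -> int) : Prop := {
  mpw_half : half h;
  mpw_half' : half h';
  mpw_outside : forall v v' k, O v v' -> h' (v', k) = h (v, k);
  mpw_outer : forall i j, i \in K -> j \notin K ->
    (h' (tau' j, idx j i) = h (tau i, idx i j) + w (~: [set i; j]))%R;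
  mpw_inner : forall i j, i \in K -> j \in K -> i != j ->
    (h (tau i, idx i j) + h (tau j, idx j i) = 0)%R;
  mpw_inner' : forall i j, i \notin K -> j \notin K -> i != j ->
    (h' (tau' i, idx i j) + h' (tau' j, idx j i) = w (~: [set i; j]))%R }.

(** The move prescribes only the weights of whole triangles. Any half weight of [X] extends to one
    of [X'] that gains [w] on the bipyramid side of each outer triangle, so an outer triangle with
    the bipyramid on both sides gains two values, as required. *)
Lemma mp_move_flip eps K w (X X' : iograph) : mp_move eps K w X X' ->
  exists (tau : 'I_5 -> vertex X) (tau' : 'I_5 -> vertex X')
         (iota : vertex X -> vertex X'),
  [/\ flip K tau tau' (outside K tau iota),
      [/\ {in K, forall i, sgn (tau i) = eps (+) odd i},
          {in ~: K, forall j, sgn (tau' j) = ~~ (eps (+) odd j)}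
        & {in ~: (tau @: K), forall v, sgn (iota v) = sgn v}]
    & forall h, half h -> exists h', mp_weights K w tau tau' (outside K tau iota) h h'].
Proof.
move=> [tau [tau' [iota [[it it' ii im] sg [g g' c] [w0 w1 w2]]]]].
exists tau, tau', iota; set O := outside K tau iota.
have fl : flip K tau tau' O.
  have O_iota v v' : O v v' -> v' \in iota @: (~: (tau @: K)).
    by move=> [vK ->]; rewrite imset_f // inE.
  split=> //.
  - by move=> v v' [].
  - by move=> v v' /O_iota; rewrite im inE.
  - by move=> v vK; exists (iota v).
  - move=> v' vK; have : v' \in iota @: (~: (tau @: K)) by rewrite im inE.
    by move=> /imsetP [v]; rewrite inE => vK' ->; exists v.
  - by move=> v v1 v2 [_ ->] [_ ->].
  - by move=> v1 v2 v' [n1 ->] [n2] /ii -> //; rewrite inE.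
  - by move=> F F' /mp_corrE /c /mp_corrE.
split=> // h hh.
(* The values required of [h']. On a new inner triangle only the sum of the two sides matters, and
   all of [w] is put on the side of the tetrahedron with the smaller index. *)
pose P (F' : vertex X' * 'I_4) (n : int) : Prop :=
  (exists2 F, fcorr K tau tau' O F F' & n = (h F + mp_outer K tau' w F')%R) \/
  (exists i j, [/\ i \notin K, j \notin K, i != j, F' = (tau' i, idx i j)
     & n = if (i < j)%N then w (~: [set i; j]) else 0%R]).
have tot F' : exists n, P F' n.
  case: F' => t k.
  have [/imsetP [i iK ->]|/(flip_total' fl) [v o]] := boolP (t \in tau' @: (~: K)).
    rewrite inE in iK; have [j ji ->] := idxK i k.
    have [jK|jK] := boolP (j \in K); eexists; [left|right].
      by eexists; last reflexivity; right; exists j, i.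
    by exists i, j; split=> //; rewrite eq_sym.
  by exists (h (v, k) + mp_outer K tau' w (t, k))%R; left; exists (v, k) => //; left.
have [h' hP] := choice tot.
have hcorr F F' : fcorr K tau tau' O F F' -> (h' F' = h F + mp_outer K tau' w F')%R.
  move=> FF'; case: (hP F') => [[F2 FF2 ->]|[i [j [iK jK ij e _]]]].
    by rewrite (fcorr_inj fl FF2 FF').
  by rewrite e in FF'; case: (fcorr_inner fl iK jK ij FF').
have hin i j : i \notin K -> j \notin K -> i != j ->
    h' (tau' i, idx i j) = if (i < j)%N then w (~: [set i; j]) else 0%R.
  move=> iK jK ij; case: (hP (tau' i, idx i j)) => [[F FF']|].
    by case: (fcorr_inner fl iK jK ij FF').
  move=> [i' [j' [iK' jK' ij' [] /it' ei]]]; rewrite -{}ei ?inE // in ij' *.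
  have ji : j != i by rewrite eq_sym.
  have ji' : j' != i by rewrite eq_sym.
  by move/eqP; rewrite idx_eq // => /eqP ->.
exists h'; split=> //.
- move=> F'; case: (hP F') => [[F FF' _]|[i [j [iK jK ij e _]]]].
    have FF2 := flip_corr fl FF'.
    rewrite (w2 F F'); last by apply/mp_corrE.
    by rewrite (hcorr _ _ FF') (hcorr _ _ FF2) hh addrACA addrA.
  have ji : j != i by rewrite eq_sym.
  rewrite e (flip_glue' fl) ?inE // w1 ?inE //.
  rewrite !hin // [in X in (_ + X)%R]setUC.
  by have [lt|lt|/val_inj e'] := ltngtP i j; rewrite ?addr0 ?add0r // -e' eqxx in ij *.
- move=> v v' k o; rewrite (hcorr (v, k) (v', k)); last by left.
  by rewrite mp_outer_notin ?addr0 //; apply: flip_notin' fl _ _ o.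
- move=> i j iK jK; rewrite (hcorr (tau i, idx i j)); last by right; exists i, j.
  by rewrite mp_outer_in.
- by move=> i j iK jK ij; have := hh (tau i, idx i j); rewrite w0 // (flip_glue fl).
- move=> i j iK jK ij; have ji : j != i by rewrite eq_sym.
  rewrite !hin // [in X in (_ + X)%R]setUC.
  by have [lt|lt|/val_inj e'] := ltngtP i j; rewrite ?addr0 ?add0r // -e' eqxx in ij *.
Qed.

(* The increase of the defect at the edge uv caused by the disappearance of D_s
   if s is in K, and by its appearance otherwise. *)
Definition flip_defect (K : {set 'I_5}) (V V' : finType) (tau : 'I_5 -> V)
    (tau' : 'I_5 -> V') (h : V * 'I_4 -> int) (h' : V' * 'I_4 -> int)
    (u v s : 'I_5) : int :=
  if s \in K then (- defect h (tau s, idx s u, idx s v))%R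
  else defect h' (tau' s, idx s u, idx s v).

Lemma card2_eq (T : finType) (K : {set T}) (i j : T) :
  #|K| = 2 -> i \in K -> j \in K -> i != j -> [set i; j] = K.
Proof.
move=> K2 iK jK ij; apply/eqP; rewrite eqEcard K2 cards2 ij andbT.
by apply/fintype.subsetP => x; rewrite !inE => /orP[] /eqP ->.
Qed.

(** With the signs of [flip_defect], the charges of the tetrahedra around [uv] combine into the
    coboundary of [w], and admissibility says that it compensates the dots, except for the -2 of the
    new edge. *)
Lemma sum_flip_defect (K : {set 'I_5}) w (X X' : iograph) (tau : 'I_5 -> vertex X)
    (tau' : 'I_5 -> vertex X') (O : vertex X -> vertex X' -> Prop)
    (h : vertex X * 'I_4 -> int) (h' : vertex X' * 'I_4 -> int) :
  #|K| = 2 -> mp_admissible K w -> mp_weights K w tau tau' O h h' ->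
  forall u v x y z : 'I_5, perm5 u v x y z ->
  (flip_defect K tau tau' h h' u v x + flip_defect K tau tau' h h' u v y
   + flip_defect K tau tau' h h' u v z
   = - (if [set u; v] == K then 2 else 0))%R.
Proof.
move=> K2 adm mw u v x y z U.
(* Old tetrahedra count negatively: the two sides then add up to [w] on an outer or a new inner
   triangle, and to 0 on the old inner one. *)
pose HH i j := if i \in K then (- h (tau i, idx i j))%R else h' (tau' i, idx i j).
have HHE i j : i != j -> (HH i j + HH j i = opp_val K w i j)%R.
  move=> ij; have ji : j != i by rewrite eq_sym.
  rewrite /HH /opp_val; case iK: (i \in K); case jK: (j \in K).
  - by rewrite (card2_eq K2 iK jK ij) eqxx -opprD (mpw_inner mw) // oppr0.
  - rewrite ifN; last by apply/eqP => e; rewrite -e !inE eqxx orbT in jK.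
    by rewrite (mpw_outer mw) ?jK // addKr.
  - rewrite ifN; last by apply/eqP => e; rewrite -e !inE eqxx in iK.
    by rewrite (mpw_outer mw) ?iK // addrAC subrr add0r setUC.
  - rewrite ifN; last by apply/eqP => e; rewrite -e !inE eqxx in iK.
    by rewrite (mpw_inner' mw) ?iK ?jK.
have chE s p q : perm5 u v s p q -> flip_defect K tau tau' h h' u v s =
   (2 * (sigma u v q * HH s p + sigma u v p * HH s q)
    - (if s \in K then - dots s u v else dots s u v))%R.
  move=> U'; rewrite /flip_defect /defect /= (charge_idx _ _ U') (charge_idx _ _ U').
  by rewrite /HH /dots; case: (s \in K); rewrite ?mulrN; lia.
have Ux : perm5 u v x y z by reperm U.
have Uy : perm5 u v y x z by reperm U.
have Uz : perm5 u v z x y by reperm U.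
rewrite (chE _ _ _ Ux) (chE _ _ _ Uy) (chE _ _ _ Uz).
have := mp_admissible2 adm U; rewrite /cobd -!HHE ?(perm5_eqF U) //.
set sx := sigma u v x; set sy := sigma u v y; set sz := sigma u v z.
by rewrite !mulrDr; lia.
Qed.

(** A face that contains both vertices of [K] is opposite to a label outside [K], hence is a new
    inner triangle. Walking around the new edge thus never leaves the new tetrahedra. *)
Lemma new_edge (K : {set 'I_5}) (X X' : ograph) (tau : 'I_5 -> vertex X)
    (tau' : 'I_5 -> vertex X') (O : vertex X -> vertex X' -> Prop) :
  #|K| = 2 -> flip K tau tau' O -> forall j (u v : 'I_5) c d',
  [set u; v] = K -> j \notin K ->
  same_edge ((tau' j, idx j u, idx j v) : corner X') d' ->
  ~ cor K tau tau' O c d'.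
Proof.
move=> K2 fl j u v c d' uvK jK.
pose N (d : corner X') := exists2 j, j \notin K & d = (tau' j, idx j u, idx j v).
have uv_in x : (x \in K) = (x == u) || (x == v) by rewrite -uvK !inE.
have step d e : corner_adj d e -> N d -> N e.
  move=> /corner_adjP [F [m [n [-> ->]]]] [i iK].
  have ui : u != i by apply: contraNneq iK => <-; rewrite uv_in eqxx.
  have vi : v != i by apply: contraNneq iK => <-; rewrite uv_in eqxx orbT.
  case: F => t k e1; have et : t = tau' i by case: e1.
  have [l li ek] := idxK i k.
  have il : i != l by rewrite eq_sym.
  subst t k.
  have [a [b [[ai al bi bl] e2 e3]]] := fcorner_idx (tau' i) m n il.
  move: e1; rewrite e2 => -[] /eqP; rewrite idx_eq // => /eqP ea.
  move=> /eqP; rewrite idx_eq // => /eqP eb; subst a b.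
  have lK : l \notin K by rewrite uv_in !negb_or ![l == _]eq_sym al.
  by exists l; rewrite // (flip_glue' fl) ?inE // e3.
move=> /connectP [p pp ->].
have : N (last (tau' j, idx j u, idx j v) p).
  have : N (tau' j, idx j u, idx j v) by exists j.
  elim: p (_, _, _) pp => //= d1 p IH d /andP[a pp] Nd.
  exact: IH pp (step _ _ a Nd).
move=> [i iK ->] [[o _]|[a [b [u' [v' [aK bK [ua ub va vb] _]]]]]].
  by move: (flip_notin' fl o); rewrite /= imset_f ?inE.
have m : i \in ~: K by rewrite inE.
have m' : b \in ~: K by rewrite inE.
move=> -[] /(flip_inj' fl m m') e; rewrite -{}e in ub vb *.
have ui : u != i by apply: contraNneq iK => <-; rewrite uv_in eqxx.
have vi : v != i by apply: contraNneq iK => <-; rewrite uv_in eqxx orbT.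
move=> /eqP; rewrite idx_eq // => /eqP eu /eqP; rewrite idx_eq // => /eqP ev.
by move: aK; rewrite uv_in eu ev eq_sym (negbTE ua) eq_sym (negbTE va).
Qed.

Lemma cor_sym S (X X' : ograph) (tau : 'I_5 -> vertex X)
    (tau' : 'I_5 -> vertex X') (O : vertex X -> vertex X' -> Prop) c c' :
  cor S tau tau' O c c' -> cor (~: S) tau' tau (fun v' v => O v v') c' c.
Proof.
case=> [[o [e1 e2]]|[i [j [u [v [iS jS [ui uj vi vj] e e']]]]]].
  by left; split.
by right; exists j, i, u, v; rewrite !inE negbK.
Qed.

Lemma set2_lt_inj n (u v u' v' : 'I_n) : u < v -> u' < v' ->
  [set u; v] = [set u'; v'] -> u = u' /\ v = v'.
Proof.
move=> uv uv' e.
have : u \in [set u'; v'] by rewrite -e !inE eqxx.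
have : v \in [set u'; v'] by rewrite -e !inE eqxx orbT.
rewrite !inE => /orP[] /eqP ev /orP[] /eqP eu; rewrite eu ev in uv *; split=> //.
- by rewrite ltnn in uv.
- by rewrite ltnNge ltnW in uv.
- by rewrite ltnNge ltnW in uv.
- by rewrite ltnn in uv.
Qed.

Lemma sum3_sub (a1 a2 a3 b1 b2 b3 f1 f2 f3 : int) :
  (a1 - b1 = f1 -> a2 - b2 = f2 -> a3 - b3 = f3 -> f1 + f2 + f3 = 0 ->
   a1 + a2 + a3 - (b1 + b2 + b3) = 0)%R.
Proof. lia. Qed.

Lemma sum_outside (K : {set 'I_5}) (X X' : ograph) (tau : 'I_5 -> vertex X)
    (tau' : 'I_5 -> vertex X') (iota : vertex X -> vertex X')
    (f : vertex X' -> int) : flip K tau tau' (outside K tau iota) ->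
  (\sum_(t' | t' \notin tau' @: (~: K)) f t' =
   \sum_(t | t \notin tau @: K) f (iota t))%R.
Proof.
move=> fl.
rewrite -(eq_bigl _ _ (fun t => in_setC t (tau @: K))).
rewrite -(big_imset _ (h := iota)) /= => [|v1 v2]; last first.
  by rewrite !inE => n1 n2 e; apply: (flip_fun' fl) => //; split=> //.
apply: eq_bigl => t'; apply/idP/imsetP => [/(flip_total' fl) [v [vK ->]]|[v]].
  by exists v => //; rewrite inE.
by rewrite inE => vK ->; apply: (flip_notin' fl) (conj vK _).
Qed.

(** At an edge with a counterpart in [X] the changes of the defects cancel for each [uv], so the sum
    remains -2. An edge without counterpart can only be the new one, where the sum of [flip_defect]
    is itself -2. *)
Lemma mp_cframed (K : {set 'I_5}) w (X X' : iograph) (tau : 'I_5 -> vertex X)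
    (tau' : 'I_5 -> vertex X') (iota : vertex X -> vertex X')
    (h : vertex X * 'I_4 -> int) (h' : vertex X' * 'I_4 -> int) :
  #|K| = 2 -> mp_admissible K w -> flip K tau tau' (outside K tau iota) ->
  mp_weights K w tau tau' (outside K tau iota) h h' -> cframed X -> cframed X'.
Proof.
move=> K2 adm fl mw frX t' p q pq; set c' : corner X' := (t', p, q).
have hh := mpw_half mw; have hh' := mpw_half' mw.
have [_] := @cframed_atP X' h' c' hh'; apply.
have SP := sum_flip_defect K2 adm mw.
rewrite big_mkcondl /= (sum_flip _ (flip_inj' fl)) (sum_outside _ fl).
have notK s : (s \in ~: K) = (s \notin K) by rewrite inE.
have cor_flip (i j u v : 'I_5) : i \in K -> j \notin K -> u != i -> u != j -> v != i ->
    v != j -> cor K tau tau' (outside K tau iota) (tau i, idx i u, idx i v)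
                  (tau' j, idx j u, idx j v).
  by move=> *; right; exists i, j, u, v.
have cor_out t i j : t \notin tau @: K ->
    cor K tau tau' (outside K tau iota) (t, i, j) (iota t, i, j).
  by move=> tK; left.
have [[c cc]|nc] := pselect (exists c : corner X,
    cor K tau tau' (outside K tau iota) c c').
- have c_lt : (c.1.2 < c.2)%N.
    case: cc => [[_ [-> ->]] //|[i [j [u [v [_ _ [ui uj vi vj] -> e]]]]]].
    by move: pq; case: e => _ -> ->; rewrite /= !lt_idx.
  have [frc _] := @cframed_atP X h c hh.
  have fr : @cframed_at X c by case: c c_lt {cc frc} => -[? ?] ?; apply: frX.
  rewrite -(frc fr) big_mkcondl /= (sum_flip _ (flip_inj fl)).
  have same d d' : cor K tau tau' (outside K tau iota) d d' ->
      same_edge c' d' = same_edge c d.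
    move=> dd; apply/idP/idP => [s|s]; last exact: (cor_same_edge fl cc s dd).
    exact: (cor_same_edge (flip_sym fl) (cor_sym cc) s (cor_sym dd)).
  congr (_ + _)%R.
    apply: eq_bigr => t tK; apply: eq_bigr => i _; apply: eq_bigr => j _.
    rewrite (same _ _ (cor_out _ _ _ tK)); case: ifP => // _.
    rewrite /defect /charge /=; congr (2 * _ - _)%R; apply: eq_bigr => k _.
    by rewrite (mpw_outside mw _ (conj tK (erefl _))).
  apply: eq_bigr => u _; apply: eq_bigr => v uv.
  have [x [y [z U]]] : exists x y z, perm5 u v x y z.
    by apply: perm5_exists; rewrite neq_ltn uv.
  apply/eqP; rewrite -subr_eq0 !(sum_perm5 _ _ U) !notK; apply/eqP.
  have e3 := SP _ _ _ _ _ U.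
  have [[xu xv] [yu yv] [zu zv]] : [/\ (x != u) * (x != v), (y != u) * (y != v)
      & (z != u) * (z != v)]%type by rewrite !(perm5_eqF U).
  have [uvK|uvK] := eqVneq [set u; v] K.
    have out (j : 'I_5) : j != u -> j != v -> (j \in K) = false /\ same_edge c' (tau' j, idx j u, idx j v) = false.
      move=> ju jv; have jK : (j \in K) = false by rewrite -uvK !inE (negbTE ju) (negbTE jv).
      split=> //; apply/negP; rewrite same_edge_sym => s.
      by apply: (new_edge K2 fl uvK (negbT jK) s cc).
    have [xK xb] := out x xu xv; have [yK yb] := out y yu yv; have [zK zb] := out z zu zv.
    by rewrite xK yK zK xb yb zb.
  have [i [iK iu iv]] : exists i, [/\ i \in K, i != u & i != v].
    have [i /and3P[]|none] := pickP (fun i => [&& i \in K, i != u & i != v]).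
      by exists i.
    case/eqP: uvK; apply/eqP; rewrite eq_sym eqEcard K2 cards2 neq_ltn uv andbT.
    apply/fintype.subsetP => i iK; rewrite !inE; apply: contraFT (none i).
    by rewrite negb_or iK.
  (* Several edges [uv] of the bipyramid may lie on the edge of [c]. For a given one, the corners at
     [uv] of all tetrahedra, old and new, lie on it together or not at all; [beta] tells which. *)
  pose beta := same_edge c (tau i, idx i u, idx i v).
  have [ui vi] : u != i /\ v != i by rewrite ![_ == i]eq_sym.
  have bX s : s \in K -> s != u -> s != v -> same_edge c (tau s, idx s u, idx s v) = beta.
    move=> sK su sv; have [->//|si] := eqVneq s i.
    apply: same_edge_congr; apply: fcorner_glue_idx; rewrite // 1?eq_sym //.
    by apply: (flip_glue fl).
  have bX' s : s \notin K -> s != u -> s != v -> same_edge c' (tau' s, idx s u, idx s v) = beta.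
    move=> sK su sv; apply: same; apply: cor_flip; rewrite // eq_sym //.
  have E s : s != u -> s != v ->
    ((if s \notin K then if same_edge c' (tau' s, idx s u, idx s v)
         then defect h' (tau' s, idx s u, idx s v) else 0 else 0)
     - (if s \in K then if same_edge c (tau s, idx s u, idx s v)
         then defect h (tau s, idx s u, idx s v) else 0 else 0)
     = if beta then flip_defect K tau tau' h h' u v s else 0)%R.
    move=> su sv; rewrite /flip_defect; case sK: (s \in K) => /=.
      by rewrite bX ?sK // sub0r; case: ifP => _; rewrite ?oppr0.
    by rewrite bX' ?sK // subr0.
  have := E x xu xv; have := E y yu yv; have := E z zu zv => Ez Ey Ex.
  rewrite (negbTE uvK) oppr0 in e3.
  by apply: (sum3_sub Ex Ey Ez); case: (beta).
have [j0 [u0 [v0 [j0K uj0 vj0 ec]]]] : exists j0 u0 v0,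
    [/\ j0 \notin K, u0 != j0, v0 != j0 & c' = (tau' j0, idx j0 u0, idx j0 v0)].
  have [/imsetP [j]|/(flip_total' fl) [v [vK e]]] := boolP (t' \in tau' @: (~: K)).
    rewrite inE => jK e.
    have [u uj eu] := idxK j p; have [v vj ev] := idxK j q.
    by exists j, u, v; rewrite /c' e eu ev.
  by case: nc; exists (v, p, q); rewrite /c' e; apply: cor_out.
have uv0 : u0 < v0 by move: pq; case: ec => _ -> ->; rewrite lt_idx.
have uvK : [set u0; v0] = K.
  apply/eqP; rewrite eq_sym eqEcard K2 cards2 neq_ltn uv0 andbT.
  apply/fintype.subsetP => i iK; rewrite !inE.
  apply: contraPT nc; rewrite negb_or => /andP[iu iv] nc; apply: nc.
  exists (tau i, idx i u0, idx i v0); rewrite ec.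
  by apply: cor_flip; rewrite // eq_sym.
rewrite big1 ?add0r => [|t tK]; last first.
  rewrite big1 // => i _; rewrite big1 // => j _; case: ifP => // s.
  by rewrite ec in s; case: (new_edge K2 fl uvK j0K s (cor_out _ _ _ tK)).
(* Every edge of the bipyramid other than [K] has a counterpart in [X] and so is not on the new
   edge. *)
transitivity (\sum_(u : 'I_5) \sum_(v : 'I_5 | (u < v)%N)
                 if [set u; v] == K then -2 else 0 : int)%R.
  apply: eq_bigr => u _; apply: eq_bigr => v uv.
  have [x [y [z U]]] : exists x y z, perm5 u v x y z.
    by apply: perm5_exists; rewrite neq_ltn uv.
  rewrite !(sum_perm5 _ _ U) !notK.
  have e3 := SP _ _ _ _ _ U.
  have [[xu xv] [yu yv] [zu zv]] : [/\ (x != u) * (x != v), (y != u) * (y != v)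
      & (z != u) * (z != v)]%type by rewrite !(perm5_eqF U).
  case: eqP => [uvK'|nuvK].
    have [eu ev] : u = u0 /\ v = v0.
      by apply: set2_lt_inj => //; rewrite uvK.
    subst u v; move: e3; rewrite uvK eqxx => <-.
    have E s : s != u0 -> s != v0 -> ((if s \notin K then
        if same_edge c' (tau' s, idx s u0, idx s v0)
        then defect h' (tau' s, idx s u0, idx s v0) else 0 else 0)
        = flip_defect K tau tau' h h' u0 v0 s)%R.
      move=> su sv; have sK : (s \in K) = false by rewrite -uvK !inE (negbTE su) (negbTE sv).
      rewrite /flip_defect sK /= ifT // ec.
      have [->|js] := eqVneq j0 s; first exact: same_edge_refl.
      apply: fcorner_glue_idx; rewrite // 1?eq_sym //.
      by apply: (flip_glue' fl); rewrite ?notK ?sK.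
    by rewrite !E.
  have [i [iK iu iv]] : exists i, [/\ i \in K, i != u & i != v].
    have [i /and3P[]|none] := pickP (fun i => [&& i \in K, i != u & i != v]).
      by exists i.
    case: nuvK; apply/eqP; rewrite eq_sym eqEcard K2 cards2 neq_ltn uv andbT.
    apply/fintype.subsetP => i iK; rewrite !inE; apply: contraFT (none i).
    by rewrite negb_or iK.
  have E s : s != u -> s != v -> ((if s \notin K then
      if same_edge c' (tau' s, idx s u, idx s v)
      then defect h' (tau' s, idx s u, idx s v) else 0 else 0) = 0)%R.
    move=> su sv; case: ifP => // sK; case: ifP => // s'; rewrite ec in s'.
    have cs : cor K tau tau' (outside K tau iota) (tau i, idx i u, idx i v)
        (tau' s, idx s u, idx s v) by apply: cor_flip; rewrite // eq_sym.
    by case: (new_edge K2 fl uvK j0K s' cs).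
  by rewrite !E.
rewrite (bigD1 u0) //= (bigD1 v0) //= uvK eqxx.
have uniq_uv (u v : 'I_5) : u < v -> [set u; v] = K -> u = u0 /\ v = v0.
  by move=> uv e; apply: set2_lt_inj => //; rewrite uvK.
rewrite !big1 ?addr0 // => [u uu0|v /andP[uv vv0]].
  rewrite big1 // => v uv; case: eqP => // /(uniq_uv _ _ uv) [e _].
  by rewrite e eqxx in uu0.
case: eqP => // /(uniq_uv _ _ uv) [_ e].
by rewrite e eqxx in vv0.
Qed.

(** * Insertion of a pillow *)

Definition face_out (V : finType) (s : V -> bool) (F : V * 'I_4) : bool :=
  s F.1 == odd F.2.

(** An involution of the faces that exchanges outgoing and incoming ones carries the same
    information as a matching of ends; this recovers the latter, which is what [ograph] asks for. *)
Definition glue_edge (V : finType) (s : V -> bool) (g : V * 'I_4 -> V * 'I_4)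
    (e : V * bool) : V * bool :=
  let F := g (e.1, out_face (s e.1) e.2) in (F.1, over_face F.2).

Lemma face_out_eq (V : finType) (s : V -> bool) (F F' : V * 'I_4) :
  face_out s F = face_out s F' -> F.1 = F'.1 -> over_face F.2 = over_face F'.2 ->
  F = F'.
Proof.
case: F F' => [t k] [t' k'] /=; rewrite /face_out /= => e et; rewrite -{}et in e *.
by move: e; case_ord k; case_ord k'; case: (s t) => //= *; congr (_, _); apply: val_inj.
Qed.

Lemma glue_edge_inj (V : finType) (s : V -> bool) (g : V * 'I_4 -> V * 'I_4) :
  involutive g -> (forall F, face_out s (g F) = ~~ face_out s F) ->
  injective (glue_edge s g).
Proof.
move=> gK go [v o] [v' o'] [e1 e2].
have out u r : face_out s (u, out_face (s u) r).
  by rewrite /face_out /=; case: (s u); case: r.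
have := @face_out_eq _ s (g (v, out_face (s v) o)) (g (v', out_face (s v') o')).
rewrite !go !out => /(_ erefl e1 e2) /(can_inj gK) [ev]; rewrite -{}ev => eo.
by congr (_, _); rewrite -(over_out (s v) o) eo over_out.
Qed.

Definition face_adj (V : finType) (g : V * 'I_4 -> V * 'I_4) : rel V :=
  fun u v => [exists k, (g (u, k)).1 == v].

Lemma glue_edge_connect (V : finType) (s : V -> bool) (g : V * 'I_4 -> V * 'I_4)
    (gK : involutive g) (go : forall F, face_out s (g F) = ~~ face_out s F) :
  (forall u v, connect (face_adj g) u v) ->
  forall u v, connect (ograph_adj (perm (glue_edge_inj gK go))) u v.
Proof.
move=> conn u v; apply: connect_sub (conn u v) => {}u {}v /existsP[k /eqP e].
have out w r : face_out s (w, r) -> r = out_face (s w) (over_face r).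
  by rewrite /face_out /= -out_faceE => /eqP.
apply: connect1; apply/existsP.
case o: (face_out s (u, k)).
  by exists (over_face k); rewrite permE /glue_edge /= -(out _ _ o) e eqxx.
have := go (u, k); rewrite o -e; case E: (g (u, k)) => [w r] /= /out er.
by exists (over_face r); rewrite !permE /glue_edge /= -er -E gK eqxx orbT.
Qed.

Definition glued_ograph (V : finType) (s : V -> bool) (g : V * 'I_4 -> V * 'I_4)
    (gK : involutive g) (go : forall F, face_out s (g F) = ~~ face_out s F)
    (V0 : 0 < #|V|) (conn : forall u v, connect (face_adj g) u v) : ograph :=
  Ograph s V0 (glue_edge_connect gK go conn).

Lemma glue_glued (V : finType) (s : V -> bool) (g : V * 'I_4 -> V * 'I_4)
    (gK : involutive g) (go : forall F, face_out s (g F) = ~~ face_out s F)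
    (V0 : 0 < #|V|) (conn : forall u v, connect (face_adj g) u v) F :
  @glue (glued_ograph gK go V0 conn) F = g F.
Proof.
set G := glued_ograph gK go V0 conn.
have outE E : @outgoing G E = face_out s E := @outgoingE G E.
have gE E : @outgoing G E -> @glue G E = g E.
  move=> oE; rewrite /glue oE /triangle_of oE /tri_in /= permE /glue_edge /=.
  have -> : (E.1, out_face (s E.1) (over_face E.2)) = E.
    by move: oE; rewrite /outgoing /= => /eqP <-; case: E.
  have : ~~ face_out s (g E) by rewrite go negbK -outE.
  by case: (g E) => w r /=; rewrite /face_out /= -in_faceE => /eqP <-.
case oF: (@outgoing G F); first exact: gE.
have oF' : @outgoing G (g F) by rewrite outE go -outE oF.
by rewrite -{1}(gK F) -(gE _ oF') glueK.
Qed.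

Definition glued_iograph (V : finType) (s : V -> bool) (g : V * 'I_4 -> V * 'I_4)
    (gK : involutive g) (go : forall F, face_out s (g F) = ~~ face_out s F)
    (V0 : 0 < #|V|) (conn : forall u v, connect (face_adj g) u v)
    (h : V * 'I_4 -> int) : iograph :=
  @Iograph (glued_ograph gK go V0 conn)
    (fun e => let F := (e.1, out_face (s e.1) e.2) in h F + h (g F))%R.

Lemma half_glued (V : finType) (s : V -> bool) (g : V * 'I_4 -> V * 'I_4)
    (gK : involutive g) (go : forall F, face_out s (g F) = ~~ face_out s F)
    (V0 : 0 < #|V|) (conn : forall u v, connect (face_adj g) u v)
    (h : V * 'I_4 -> int) :
  @half (glued_iograph gK go V0 conn h) h.
Proof.
set Y := glued_iograph gK go V0 conn h.
have hE E : @outgoing Y E -> @fwt Y E = (h E + h (g E))%R.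
  move=> oE; rewrite /fwt /triangle_of oE /=.
  by move: oE; rewrite /outgoing /= => /eqP <-; case: E.
move=> F; rewrite [glue _]glue_glued; case oF: (@outgoing Y F); first exact: hE.
rewrite -fwt_glue [glue _]glue_glued hE ?gK ?[(h F + _)%R]addrC //.
by rewrite -(@glue_glued V s g gK go V0 conn) outgoing_glue oF.
Qed.

Lemma face_adj_connect (G : ograph) (u v : vertex G) :
  connect (face_adj (@glue G)) u v.
Proof.
apply: connect_sub (ograph_connected u v) => {}u {}v /existsP[o /orP[] /eqP e];
  apply/connect1/existsP.
  by exists (out_face (sgn u) o); have /= := glue_tri_out (u, o); rewrite /tri_out /= => ->; rewrite /= e.
have := glue_tri_in (v, o); rewrite /tri_in /= e => g.
by exists (in_face (sgn u) (edge G (v, o)).2); rewrite g.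
Qed.

(* The disjoint union of G and of a 3-sphere made of two tetrahedra glued along
   their four faces.  Exchanging F1 and F2 with the faces q and p of the second
   new tetrahedron, as [cut] does, turns it into G with a pillow inserted; this
   covers both the case glue F1 <> F2 and that of a stack, glue F1 = F2. *)
Definition double_glue (G : ograph) (F : (vertex G + bool) * 'I_4) :
    (vertex G + bool) * 'I_4 :=
  match F.1 with
  | inl v => let F' := @glue G (v, F.2) in (inl F'.1, F'.2)
  | inr b => (inr (~~ b), F.2)
  end.

Definition old_face (G : ograph) (F : vertex G * 'I_4) :
  (vertex G + bool) * 'I_4 := (inl F.1, F.2).

Definition cut (G : ograph) (F1 F2 : vertex G * 'I_4) (p q : 'I_4)
    (F : (vertex G + bool) * 'I_4) : (vertex G + bool) * 'I_4 :=
  tperm (old_face F2) (inr true, p) (tperm (old_face F1) (inr true, q) F).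

Definition uncut (G : ograph) (F1 F2 : vertex G * 'I_4) (p q : 'I_4)
    (F : (vertex G + bool) * 'I_4) : (vertex G + bool) * 'I_4 :=
  tperm (old_face F1) (inr true, q) (tperm (old_face F2) (inr true, p) F).

Definition pillow_glue (G : ograph) (F1 F2 : vertex G * 'I_4) (p q : 'I_4)
    (F : (vertex G + bool) * 'I_4) : (vertex G + bool) * 'I_4 :=
  cut F1 F2 p q (double_glue (uncut F1 F2 p q F)).

Definition pillow_sign (G : ograph) (st : bool) (v : vertex G + bool) : bool :=
  match v with inl v => sgn v | inr b => b (+) st end.

Lemma double_glueK (G : ograph) : involutive (@double_glue G).
Proof.
case=> [[v|b] k]; rewrite /double_glue /=; last by rewrite negbK.
by rewrite -surjective_pairing glueK.
Qed.

Lemma uncutK (G : ograph) (F1 F2 : vertex G * 'I_4) p q :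
  cancel (uncut F1 F2 p q) (cut F1 F2 p q).
Proof. by move=> F; rewrite /cut /uncut !tpermK. Qed.

Lemma cutK (G : ograph) (F1 F2 : vertex G * 'I_4) p q :
  cancel (cut F1 F2 p q) (uncut F1 F2 p q).
Proof. by move=> F; rewrite /cut /uncut !tpermK. Qed.

Lemma pillow_glueK (G : ograph) (F1 F2 : vertex G * 'I_4) p q :
  involutive (pillow_glue F1 F2 p q).
Proof. by move=> F; rewrite /pillow_glue cutK double_glueK uncutK. Qed.

Lemma pillow_glue_cut (G : ograph) (F1 F2 : vertex G * 'I_4) p q F :
  pillow_glue F1 F2 p q (cut F1 F2 p q F) = cut F1 F2 p q (double_glue F).
Proof. by rewrite /pillow_glue cutK. Qed.

(** By the hypotheses, each transposition of [cut] exchanges two outgoing or two incoming faces, so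
    conjugating by [cut] preserves the compatibility with orientations. *)
Lemma pillow_glue_out (G : ograph) (st : bool) (F1 F2 : vertex G * 'I_4) (p q : 'I_4) :
  outgoing F1 = (~~ st == odd q) -> outgoing F2 = (~~ st == odd p) ->
  forall F, face_out (@pillow_sign G st) (pillow_glue F1 F2 p q F) =
            ~~ face_out (@pillow_sign G st) F.
Proof.
move=> o1 o2 F; set s := @pillow_sign G st.
have tp A B : face_out s A = face_out s B -> forall C,
    face_out s (tperm A B C) = face_out s C.
  by move=> e C; case: tpermP => [->|->|].
have e1 : face_out s (old_face F1) = face_out s (inr true, q).
  by rewrite /face_out /= -outgoingE o1.
have e2 : face_out s (old_face F2) = face_out s (inr true, p).
  by rewrite /face_out /= -outgoingE o2.
rewrite /pillow_glue /cut tp // tp //.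
have -> C : face_out s (double_glue C) = ~~ face_out s C.
  case: C => [[v|b] k]; rewrite /face_out /double_glue /=.
    by rewrite -!outgoingE outgoing_glue outgoingE.
  by clear; case: b; case: st; case: (odd k).
by rewrite /uncut tp // tp.
Qed.

Lemma old_face_inj (G : ograph) : injective (@old_face G).
Proof. by move=> [t k] [t' k'] [-> ->]. Qed.

Lemma cutE (G : ograph) (F1 F2 : vertex G * 'I_4) (p q : 'I_4) :
  p != q -> F1 != F2 ->
  [/\ cut F1 F2 p q (old_face F1) = (inr true, q),
      cut F1 F2 p q (old_face F2) = (inr true, p),
      cut F1 F2 p q (inr true, q) = old_face F1,
      cut F1 F2 p q (inr true, p) = old_face F2
    & (forall F, F \notin [:: F1; F2] ->
         cut F1 F2 p q (old_face F) = old_face F) /\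
      (forall b k, ~~ b || (k \notin [:: p; q]) ->
         cut F1 F2 p q (inr b, k) = (inr b, k))].
Proof.
move=> pq F12; have qp : q != p by rewrite eq_sym.
have old_eq F F' : (old_face F == old_face F') = (F == F').
  by apply/eqP/eqP => [/old_face_inj|->].
have F21 : F2 != F1 by rewrite eq_sym.
rewrite /cut; split.
- by rewrite tpermL tpermD // xpair_eqE /= eqxx.
- by rewrite (@tpermD _ (old_face F1)) ?old_eq // tpermL.
- by rewrite tpermR tpermD // ?old_eq.
- by rewrite (@tpermD _ (old_face F1)) ?tpermR // xpair_eqE /= eqxx.
- split=> [F|b k]; rewrite !inE.
    by rewrite negb_or => /andP[n1 n2]; rewrite !tpermD // old_eq eq_sym.
  by rewrite negb_or => H; rewrite !tpermD //; move: H;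
    rewrite xpair_eqE ![_ == k]eq_sym; case: b => //= /andP[].
Qed.

Lemma glue_neq (G : ograph) (F : vertex G * 'I_4) : @glue G F != F.
Proof. by apply/eqP => e; have := outgoing_glue F; rewrite e; case: outgoing. Qed.

Lemma pillow_glueE (G : ograph) (F1 F2 : vertex G * 'I_4) (p q : 'I_4) :
  p != q -> F1 != F2 ->
  [/\ pillow_glue F1 F2 p q (old_face F1) = (inr false, q),
      pillow_glue F1 F2 p q (old_face F2) = (inr false, p),
      pillow_glue F1 F2 p q (inr true, q) =
        if @glue G F1 == F2 then (inr true, p) else old_face (@glue G F1),
      pillow_glue F1 F2 p q (inr true, p) =
        if @glue G F1 == F2 then (inr true, q) else old_face (@glue G F2)
    & (forall F, F \notin [:: F1; F2; @glue G F1; @glue G F2] ->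
         pillow_glue F1 F2 p q (old_face F) = old_face (@glue G F)) /\
      (forall b k, k \notin [:: p; q] ->
         pillow_glue F1 F2 p q (inr b, k) = (inr (~~ b), k))].
Proof.
move=> pq F12; have [c1 c2 c3 c4 [c5 c6]] := cutE pq F12.
have dold F : double_glue (old_face F) = old_face (@glue G F) by case: F.
have glue_eq F F' : (@glue G F == F') = (F == @glue G F').
  by apply/eqP/eqP => [<-|->]; rewrite glueK.
split.
- by rewrite -c3 pillow_glue_cut /double_glue /= c6.
- by rewrite -c4 pillow_glue_cut /double_glue /= c6.
- rewrite -c1 pillow_glue_cut dold; case: eqP => [->//|/eqP n].
  by rewrite c5 // !inE negb_or glue_neq.
- rewrite -c2 pillow_glue_cut dold glue_eq eq_sym; case: eqP => [->//|/eqP n].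
  by rewrite c5 // !inE negb_or glue_neq andbT.
split=> [F|b k kpq].
  rewrite !inE !negb_or => /and4P[n1 n2 n3 n4].
  rewrite -[X in pillow_glue _ _ _ _ X](c5 F) ?inE ?negb_or ?n1 //.
  by rewrite pillow_glue_cut dold c5 // !inE negb_or !glue_eq n3.
rewrite -[X in pillow_glue _ _ _ _ X](c6 b k) ?kpq ?orbT //.
by rewrite pillow_glue_cut /double_glue /= c6 // kpq orbT.
Qed.

Lemma pillow_connect (G : ograph) (F1 F2 : vertex G * 'I_4) (p q r : 'I_4) :
  p != q -> F1 != F2 -> r \notin [:: p; q] ->
  forall u v, connect (face_adj (pillow_glue F1 F2 p q)) u v.
Proof.
move=> pq F12 rpq; set g := pillow_glue F1 F2 p q.
have := pillow_glueE pq F12; rewrite -/g => -[g1 g2 g3 g4 [g5 g6]].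
have sym : connect_sym (face_adj g).
  have H u v : face_adj g u v -> face_adj g v u.
    move=> /existsP[k /eqP <-]; apply/existsP; exists (g (u, k)).2.
    by rewrite -surjective_pairing /g pillow_glueK.
  by apply: sym_connect_sym => u v; apply/idP/idP; apply: H.
have adj F : connect (face_adj g) F.1 (g F).1.
  by apply/connect1/existsP; exists F.2; rewrite -surjective_pairing.
have ab : connect (face_adj g) (inr false) (inr true).
  by have := adj (inr false, r); rewrite g6.
have c1 : connect (face_adj g) (inl F1.1) (inr false).
  by have := adj (old_face F1); rewrite g1.
have c2 : connect (face_adj g) (inl F2.1) (inr false).
  by have := adj (old_face F2); rewrite g2.
have ba : connect (face_adj g) (inr true) (inr false) by rewrite sym.
have c3 : connect (face_adj g) (inl (@glue G F1).1) (inr false).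
  have := adj (inr true, q); rewrite g3; case: eqP => [-> //|_ /= H].
  by apply: connect_trans ba; rewrite sym.
have c4 : connect (face_adj g) (inl (@glue G F2).1) (inr false).
  have := adj (inr true, p); rewrite g4; case: eqP => [<- |_ /= H].
    by rewrite glueK.
  by apply: connect_trans ba; rewrite sym.
have step F : connect (face_adj g) (inl F.1) (inl (@glue G F).1).
  have join a b : connect (face_adj g) a (inr false) ->
      connect (face_adj g) b (inr false) -> connect (face_adj g) a b.
    by move=> ha hb; apply: connect_trans ha _; rewrite sym.
  have [|n] := boolP (F \in [:: F1; F2; @glue G F1; @glue G F2]); last first.
    by have := adj (old_face F); rewrite g5.
  by rewrite !inE => /or4P[] /eqP ->; rewrite ?glueK; apply: join.
have old u v : connect (face_adj g) (inl u) (inl v).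
  have /connectP [s] := face_adj_connect u v.
  elim: s u => [|w s IH] u /=; first by move=> _ ->; apply: connect0.
  move=> /andP[/existsP[k /eqP <-] ps] e; apply: connect_trans (IH _ ps e).
  exact: step (u, k).
have toa u : connect (face_adj g) u (inr false).
  by case: u => [u|[]] //; apply: connect_trans (old u F1.1) c1.
by move=> u v; apply: connect_trans (toa u) _; rewrite sym.
Qed.

Lemma card_sum_bool_gt0 (T : finType) : 0 < #|{: T + bool}|.
Proof. by apply/card_gt0P; exists (inr true). Qed.

Definition pillow_iograph (X : iograph) (st : bool) (F1 F2 : vertex X * 'I_4)
    (p q r : 'I_4) (pq : p != q) (F12 : F1 != F2) (rpq : r \notin [:: p; q])
    (o1 : @outgoing X F1 = (~~ st == odd q)) (o2 : @outgoing X F2 = (~~ st == odd p))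
    (h : (vertex X + bool) * 'I_4 -> int) : iograph :=
  glued_iograph (@pillow_glueK X F1 F2 p q) (pillow_glue_out o1 o2)
    (card_sum_bool_gt0 _) (pillow_connect pq F12 rpq) h.

(** The weights of [f_i'] and [f_i''] add up to that of [f_i] plus the half weights on two
    corresponding faces of the pillow, and an inner triangle has weight [hs]. So (i) and (ii) are
    equations in [hs] alone, whatever the old weights are. *)
Lemma pillow_slide (X : iograph) (st : bool) (F1 F2 : vertex X * 'I_4)
    (x y p q r : 'I_4) (pq : p != q) (F12 : F1 != F2) (rpq : r \notin [:: p; q])
    (o1 : @outgoing X F1 = (~~ st == odd q)) (o2 : @outgoing X F2 = (~~ st == odd p))
    (h : vertex X * 'I_4 -> int) (hY : (vertex X + bool) * 'I_4 -> int)
    (hs := fun k => (hY (inr false, k) + hY (inr true, k))%R)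
    (Y := pillow_iograph pq F12 rpq o1 o2 hY) :
  uniq [:: x; y; p; q] -> x < y ->
  ~~ ((p < x) && (q < x)) -> ~~ ((y < p) && (y < q)) ->
  half h -> (forall F, hY (old_face F) = h F) ->
  same_edge (@fcorner X F1 (idx q x) (idx q y)) (@fcorner X F2 (idx p x) (idx p y)) ->
  (forall s s' : 'I_4, (s, s') \in [:: (x, y); (y, x)] ->
     sigma s p s' * hs q + sigma s p q * hs s' = (dotted s p)%:Z /\
     sigma s q s' * hs p + sigma s q p * hs s' = (dotted s q)%:Z)%R ->
  (sigma p q x * hs y + sigma p q y * hs x = -1 + (dotted p q)%:Z)%R ->
  @cframed_at Y (inr false, x, y) -> @cframed_at Y (inr true, x, y) ->
  slide_move X Y.
Proof.
move=> Uxy xy low high hh hYold se c1 c2 fra frb.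
have := pillow_glueE pq F12; set g := pillow_glue F1 F2 p q.
move=> [g1 g2 g3 g4 [g5 g6]].
have gY F : @glue Y F = g F by exact: glue_glued.
have hhY : @half Y hY by exact: half_glued.
have fY F : @fwt Y F = (hY F + hY (g F))%R by rewrite hhY gY.
have gK : involutive g by apply: pillow_glueK.
pose iota : vertex X -> vertex Y := inl.
have xpq : x \notin [:: p; q].
  by move: Uxy; rewrite /= !inE !negb_or => /andP[/and3P[_ -> ->]].
have ypq : y \notin [:: p; q].
  by move: Uxy; rewrite /= !inE !negb_or => /and3P[_ /andP[-> ->]].
have pil : @pillow X Y iota (inr false) (inr true) x y p q.
  split=> //.
  - by move=> u v [].
  - apply/setP => v; rewrite !inE; apply/imsetP/idP => [[u _ ->] //|].
    by case: v => [v|[]] //= _; exists v.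
  - by rewrite gY g6.
  - by rewrite gY g6.
have sw z1 z2 : @slide_weights Y (inr false) (inr true) x y p q z1 z2
    (z1 + hs q)%R (z2 + hs p)%R.
  have fk k : k \notin [:: p; q] -> @fwt Y (inr false, k) = hs k.
    by move=> kpq; rewrite fY g6.
  split=> //; last by rewrite !fk.
  move=> s s' ss; have [e1 e2] := c1 s s' ss.
  have s'pq : s' \notin [:: p; q].
    by move: ss; rewrite in_cons mem_seq1 => /orP[] /eqP [_ ->].
  by rewrite fk // (mulrDr _ z1) (mulrDr _ z2) -(addrA (_ * z1)%R) -(addrA (_ * z2)%R) e1 e2.
have pushE F : @push X Y iota F = old_face F by [].
have F21 : F2 != F1 by rewrite eq_sym.
have gg F : (@glue X F == F) = false by apply/negbTE/glue_neq.
case: (eqVneq (@glue X F1) F2) => [e12|n12].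
  have e21 : @glue X F2 = F1 by rewrite -e12 glueK.
  have v12 : @fwt Y (inr true, q) = (hY (inr true, q) + hY (inr true, p))%R.
    by rewrite fY g3 e12 eqxx.
  (* The weight of the doubled triangle is distributed as its two half weights; likewise [v1], [v2]
     for the triangle between the inner faces of the pillow. *)
  apply: (@slide_stack X Y iota (inr false) (inr true) (inr false) (inr true)
    x y p q F1 (h F1) (h F2) (hY (inr true, q)) (hY (inr true, p)) pil) => //.
  - apply: same_edge_trans se _; rewrite -e21; exact: same_edge_glue.
  - move=> F; rewrite e12 => nF; rewrite pushE gY fY g5; last first.
      by move: nF; rewrite e12 e21 !inE => /norP[/negbTE -> /negbTE ->].
    by rewrite !hYold hh.
  - by rewrite pushE gY g1.
  - by rewrite e12 pushE gY g2.
  - by rewrite gY g3 e12 eqxx.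
  - by rewrite hh e12.
  - have := sw (h F1) (h F2); rewrite !fY -g1 -g2 !gK !hYold g1 g2 /hs.
    by rewrite !addrA ![(h _ + hY _)%R]addrC.
apply: (@slide_distinct X Y iota (inr false) (inr true) x y p q F1 F2 pil) => //.
- by rewrite !inE negb_or F21 eq_sym.
- move=> F nF; rewrite pushE gY fY g5; last by move: nF; rewrite !inE !negb_or => /and4P[-> -> -> ->].
  by rewrite !hYold hh.
- by rewrite pushE gY g1.
- by rewrite pushE gY; move: g3; rewrite (negbTE n12) => <-; rewrite gK.
- by rewrite pushE gY g2.
- by rewrite pushE gY; move: g4; rewrite (negbTE n12) => <-; rewrite gK.
- have := sw (@fwt X F1) (@fwt X F2).
  have -> : (@fwt X F1 + hs q = @fwt Y (inr false, q) + @fwt Y (inr true, q))%R.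
    by rewrite !fY -g1 gK g1 g3 (negbTE n12) !hYold hh /hs; ring.
  have -> : (@fwt X F2 + hs p = @fwt Y (inr false, p) + @fwt Y (inr true, p))%R.
    by rewrite !fY -g2 gK g2 g4 (negbTE n12) !hYold hh /hs; ring.
  by [].
Qed.

(** * Chains of the 4-simplex and H-moves *)

(** The sign of the vertex compares its orientation with the one given by the order; correcting the
    multiplicity by it makes the H-moves add [z] times the ordered boundary of [D_i]. *)
Lemma hsign_sg5 (X : iograph) (t : vertex X) (i j : 'I_5) (z : int) :
  hsign (t, idx i j) (if sgn t then z else - z)%R = (z * sg5 i j)%R.
Proof.
rewrite /hsign outgoingE /= /sg5.
by case: (sgn t); case: odd; rewrite /= ?mulrN ?mulr1 ?opprK.
Qed.

(* The coefficients of D_i in a 3-chain whose boundary agrees with the 2-chain W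
   on the triangles of D_a. *)
Definition cone (W : 'I_5 -> 'I_5 -> int) (a i : 'I_5) : int :=
  (W a i * sg5 i a)%R.

(** The boundary of a boundary at [uv], for a 3-chain with coefficient 0 at [D_c]: only [D_x] and
    [D_y] remain among the tetrahedra that contain [uv]. *)
Lemma cobd_boundary (z : 'I_5 -> int) (u v x y c : 'I_5) : perm5 u v x y c ->
  (sigma u v c * (z x * sg5 x y + z y * sg5 y x)
   + sigma u v x * (z y * sg5 y c) + sigma u v y * (z x * sg5 x c) = 0)%R.
Proof.
move=> U.
have E s1 s2 r : perm5 u v s1 s2 r ->
   (sigma u v s1 * sg5 r s2 = - (sigma u v s2 * sg5 r s1))%R.
  move=> U'; have := sigma_sg5 U'.
  by rewrite /sg5 /sigma; do 4!case: ifP.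
have U1 : perm5 u v c y x by reperm U.
have U2 : perm5 u v c x y by reperm U.
have E1 := E _ _ _ U1; have E2 := E _ _ _ U2.
have -> : (sigma u v c * (z x * sg5 x y + z y * sg5 y x) =
  z x * (sigma u v c * sg5 x y) + z y * (sigma u v c * sg5 y x))%R by ring.
by rewrite E1 E2; ring.
Qed.

Lemma mp_move_intro eps K w (X X' : iograph) (tau : 'I_5 -> vertex X)
    (tau' : 'I_5 -> vertex X') (iota : vertex X -> vertex X') h h' :
  flip K tau tau' (outside K tau iota) ->
  {in K, forall i, sgn (tau i) = eps (+) odd i} ->
  {in ~: K, forall j, sgn (tau' j) = ~~ (eps (+) odd j)} ->
  {in ~: (tau @: K), forall v, sgn (iota v) = sgn v} ->
  mp_weights K w tau tau' (outside K tau iota) h h' ->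
  mp_move eps K w X X'.
Proof.
move=> fl s1 s2 s3 mw; exists tau, tau', iota.
have hcorr F F' : fcorr K tau tau' (outside K tau iota) F F' ->
    h' F' = (h F + mp_outer K tau' w F')%R.
  case: F F' => [t k] [t' k'] [[o /= <-]|[i [j [iK jK [-> ->] [-> ->]]]]].
    by rewrite (mpw_outside mw _ o) mp_outer_notin ?addr0 //; apply: flip_notin' fl _ _ o.
  by rewrite (mpw_outer mw) // mp_outer_in //; apply: flip_inj' fl.
split; split.
- exact: flip_inj fl.
- exact: flip_inj' fl.
- move=> v1 v2; rewrite !inE => n1 n2 e.
  by apply: (flip_fun' fl (v' := iota v1)); split.
- apply/setP => v'; rewrite [in RHS]inE; apply/imsetP/idP => [[v]|/(flip_total' fl) [v [vK ->]]].
    by rewrite inE => vK ->; apply: (flip_notin' fl) (conj vK erefl).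
  by exists v; rewrite ?inE.
- exact: s1.
- exact: s2.
- exact: s3.
- exact: flip_glue fl.
- exact: flip_glue' fl.
- by move=> F F' /mp_corrE /(flip_corr fl) /mp_corrE.
- move=> i j iK jK ij; rewrite (mpw_half mw) (flip_glue fl) //.
  exact: (mpw_inner mw).
- move=> i j iK jK ij; rewrite (mpw_half' mw) (flip_glue' fl) //.
  by apply: (mpw_inner' mw); rewrite // -in_setC.
- move=> F F' /mp_corrE FF'; rewrite (mpw_half mw) (mpw_half' mw).
  by rewrite (hcorr _ _ FF') (hcorr _ _ (flip_corr fl FF')) addrACA addrA.
Qed.

Lemma slide_chain (K K' : {set 'I_5}) w w' (a b c d e : 'I_5)
    (U := fun i j => (opp_val K w i j + opp_val K' w' i j)%R) :
  perm5 a b c d e -> [set a; b] = K -> [set d; e] = K' ->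
  mp_admissible K w -> mp_admissible K' w' ->
  exists z : 'I_5 -> int, [/\ z a = 0%R, z c = 0%R,
   (forall i j, i != j -> i != c -> j != c -> U i j = z i * sg5 i j + z j * sg5 j i)%R
   & (forall u v x y, perm5 u v x y c ->
     (sigma u v x * (U c y - z y * sg5 y c) + sigma u v y * (U c x - z x * sg5 x c))%R
     = (dots c u v - (if [set u; v] == K then 1 else 0)
                   - (if [set u; v] == K' then 1 else 0))%R)].
Proof.
move=> P KE KE' adm adm'.
(* Triangles through [c] are not faces of [D_c], so its coefficient is free. The alternating sum of
   the other four tetrahedra has no boundary there either, so the coefficient of [D_a] can be
   normalised to 0 as well. *)
pose z i := if i \in [:: b; d; e] then cone U a i else 0%R.
have Us i j : U i j = U j i by rewrite /U !(opp_val_sym _ _ j).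
pose D i u v : int := if i == c then dots i u v else 0%R.
(* [D_a], [D_b] disappear in the first move and appear in the second, [D_d], [D_e] conversely, so
   their dots cancel. Those of [D_c] are counted twice, and the common factor 2 is dropped. *)
have dU u v x y s : perm5 u v x y s -> (cobd U u v x y s = D x u v + D y u v + D s u v
    - (if [set u; v] == K then 1 else 0) - (if [set u; v] == K' then 1 else 0))%R.
  move=> Q; have e1 := mp_admissible2 adm Q; have e2 := mp_admissible2 adm' Q.
  have f i : ((if i \in K then - dots i u v else dots i u v) +
              (if i \in K' then - dots i u v else dots i u v) = 2 * D i u v)%R.
    rewrite /D; move: i; apply: (perm5_ind P);
      rewrite -?KE -?KE' !inE ?eqxx ?(perm5_eqF P) /=; lia.
  have fx := f x; have fy := f y; have fs := f s.
  have -> : cobd U u v x y s = (cobd (opp_val K w) u v x y s + cobd (opp_val K' w') u v x y s)%R.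
    by rewrite /cobd /U !mulrDr; ring.
  move: e1 e2 fx fy fs; move: (cobd _ _ _ _ _ _) (cobd _ _ _ _ _ _) => C1 C2.
  have twice (k : bool) : ((if k then 2 else 0 : int) = 2 * (if k then 1 else 0))%R by case: k.
  rewrite !twice.
  move: (D x u v) (D y u v) (D s u v) (_ == K) (_ == K') => Dx Dy Ds k k'.
  move: (if x \in K then _ else _) (if x \in K' then _ else _) => x1 x2.
  move: (if y \in K then _ else _) (if y \in K' then _ else _) => y1 y2.
  move: (if s \in K then _ else _) (if s \in K' then _ else _) => s1 s2.
  move: (if k then _ else _)%R (if k' then _ else _)%R => m1 m2.
  clear; lia.
(* [D_c] has no edge through [c], and [ck] is neither [ab] nor [de]: [U] is a cycle near [c]. *)
have dUc k i j : perm5 c k a i j -> cobd U c k a i j = 0%R.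
  move=> Q; rewrite dU // /D; do 3![rewrite ifN; last by rewrite eq_sym ?(perm5_eqF Q)].
  rewrite ifN; last first.
    by apply/eqP => E; have := set21 c k; rewrite E -KE !inE ![c == _]eq_sym ?(perm5_eqF P).
  rewrite ifN //.
  by apply/eqP => E; have := set21 c k; rewrite E -KE' !inE ?(perm5_eqF P).
have N1 i j : i != j -> i != c -> j != c -> U i j = (z i * sg5 i j + z j * sg5 j i)%R.
  have coneE i' j' k : i' \in [:: b; d; e] -> j' \in [:: b; d; e] -> perm5 c k a i' j' ->
      (U i' j' = z i' * sg5 i' j' + z j' * sg5 j' i')%R.
    move=> hi hj Q; rewrite /z hi hj /cone.
    exact: (opp_val_cone Us Q (dUc _ _ _ Q)).
  have apex j' : j' \in [:: b; d; e] -> (U a j' = z a * sg5 a j' + z j' * sg5 j' a)%R.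
    move=> hj; rewrite /z hj /cone !inE !(perm5_eqF P) /= mul0r add0r.
    by rewrite -mulrA sg5_sq mulr1.
  have bI : b \in [:: b; d; e] by rewrite !inE eqxx.
  have dI : d \in [:: b; d; e] by rewrite !inE eqxx orbT.
  have eI : e \in [:: b; d; e] by rewrite !inE eqxx !orbT.
  move: i j; apply: (perm5_ind P); apply: (perm5_ind P); rewrite ?eqxx // => _ _ _;
    do ?[exact: apex]; do ?[by rewrite Us addrC; apply: apex].
  + by apply: (coneE _ _ e) => //; reperm P.
  + by apply: (coneE _ _ d) => //; reperm P.
  + by apply: (coneE _ _ e) => //; reperm P.
  + by apply: (coneE _ _ b) => //; reperm P.
  + by apply: (coneE _ _ d) => //; reperm P.
  + by apply: (coneE _ _ b) => //; reperm P.
exists z; split=> //; [by rewrite /z !inE !(perm5_eqF P)| by rewrite /z !inE !(perm5_eqF P)|].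
move=> u v x y Q; have := dU _ _ _ _ _ Q; have := cobd_boundary z Q.
rewrite /D eqxx !(perm5_eqF Q) /cobd (N1 x y) ?(perm5_eqF Q) // (Us x c) (Us y c) => B.
rewrite !add0r => <-; rewrite -[RHS]subr0 -[X in (_ = _ - X)%R]B; ring.
Qed.

(** * Reduction of one MP move to another *)

Definition pillow_tau (V : finType) (tau : 'I_5 -> V) (c j : 'I_5) : V + bool :=
  if j == c then inr false else inl (tau j).

(* The default value inr true is only used at v' = vc. *)
Definition pillow_iota (V V' : finType) (A : {set V}) (iota : V -> V') (vc v' : V') :
    V + bool :=
  if v' == vc then inr true
  else if [pick v | (v \notin A) && (iota v == v')] is Some v then inl v
  else inr true.

(** Seen from [G'], the vertex [tau' c] stays outside the second bipyramid and becomes the mirror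
    image [inr true], while [D_d], [D_e] give way to the old [D_a], [D_b] and to [inr false] as
    [D_c]. *)
Lemma pillow_flip (G G' : ograph) (a b c d e : 'I_5) (tau : 'I_5 -> vertex G)
    (tau' : 'I_5 -> vertex G') (iota : vertex G -> vertex G')
    (K := [set a; b]) (K' := [set d; e])
    (g := @pillow_glue G (tau b, idx b c) (tau a, idx a c) (idx c a) (idx c b))
    (s : vertex G + bool -> bool) (gK : involutive g)
    (go : forall F, face_out s (g F) = ~~ face_out s F)
    (V0 : 0 < #|{: vertex G + bool}|) (conn : forall u v, connect (face_adj g) u v)
    (Y := glued_ograph gK go V0 conn)
    (iota' := pillow_iota (tau @: K) iota (tau' c) : vertex G' -> vertex Y)
    (tauY := pillow_tau tau c : 'I_5 -> vertex Y) :
  perm5 a b c d e -> flip K tau tau' (outside K tau iota) ->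
  [/\ flip K' tau' tauY (outside K' tau' iota'), iota' (tau' c) = inr true
    & forall v, v \notin tau @: K -> iota' (iota v) = inl v].
Proof.
move=> P fl.
have glueY F : @glue Y F = g F by exact: glue_glued.
have [aK bK] : a \in K /\ b \in K by rewrite !inE !eqxx orbT.
have [cK dK eK] : [/\ c \notin K, d \notin K & e \notin K] by rewrite !inE !(perm5_eqF P).
have nK j : (j \notin K) = (j == c) || (j \in K').
  by move: j; apply: (perm5_ind P); rewrite !inE ?eqxx ?(perm5_eqF P).
have K'K j : j \in K' -> j \notin K by move=> jK; rewrite nK jK orbT.
have nK' j : (j \notin K') = (j == c) || (j \in K).
  by move: j; apply: (perm5_ind P); rewrite !inE ?eqxx ?(perm5_eqF P).
have cK' : c \notin K' by rewrite nK' eqxx.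
have Kc j : j \in K -> j != c by move=> jK; apply: contraNneq cK => <-.
have K'c j : j \in K' -> j != c by move=> jK; apply: contraNneq cK' => <-.
have inC j : j \notin K -> j \in ~: K by rewrite in_setC.
have tab : tau a != tau b.
  by apply/eqP => /(flip_inj fl aK bK) E; move: P; rewrite E /perm5 /= !inE eqxx.
have pq : idx c a != idx c b by rewrite idx_eq ?(perm5_eqF P).
have F12 : (tau b, idx b c) != (tau a, idx a c).
  by rewrite xpair_eqE eq_sym (negbTE tab).
have [c1 c2 c3 c4 [c5 c6]] := cutE pq F12.
rewrite -/K -/K' in c1 c2 c3 c4 c5 c6 *.
have iota_c : iota' (tau' c) = inr true by rewrite /iota' /pillow_iota eqxx.
have iota_out v : v \notin tau @: K -> iota v != tau' c.
  move=> vK; have := flip_notin' fl (conj vK erefl).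
  by apply: contraNneq => ->; rewrite imset_f ?inC.
have iota_o v : v \notin tau @: K -> iota' (iota v) = inl v.
  move=> vK; rewrite /iota' /pillow_iota (negbTE (iota_out v vK)).
  case: pickP => [v2 /andP[v2K /eqP E]|/(_ v)]; last by rewrite vK eqxx.
  by congr inl; apply: (flip_fun' fl (v' := iota v)).
have tau'_inj i j : i \notin K -> j \notin K -> tau' i = tau' j -> i = j.
  by move=> iK jK; apply: (flip_inj' fl); apply: inC.
have out' v' : v' \notin tau' @: K' ->
    v' = tau' c \/ exists2 v, v \notin tau @: K & v' = iota v.
  move=> v'K; have [/imsetP [j]|/(flip_total' fl) [v [vK ->]]] := boolP (v' \in tau' @: (~: K)).
    rewrite in_setC nK => /orP[/eqP ->|jK'] E; first by left.
    by move: v'K; rewrite E imset_f.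
  by right; exists v.
have c_out : tau' c \notin tau' @: K'.
  apply/imsetP => -[j jK' /(tau'_inj _ _ cK (K'K _ jK')) E].
  by move: cK'; rewrite E jK'.
have iota_out' v : v \notin tau @: K -> iota v \notin tau' @: K'.
  move=> vK; have := flip_notin' fl (conj vK erefl).
  by apply: contra => /imsetP [j /K'K jK ->]; rewrite imset_f // inC.
have tauYc : tauY c = inr false by rewrite /tauY /pillow_tau eqxx.
have tauYK j : j \in K -> tauY j = inl (tau j).
  by move=> jK; rewrite /tauY /pillow_tau (negbTE (Kc _ jK)).
have cut_old v k : v \notin tau @: K ->
    cut (tau b, idx b c) (tau a, idx a c) (idx c a) (idx c b) (old_face (v, k)) = old_face (v, k).
  move=> vK; apply: c5; rewrite !inE !xpair_eqE.
  have -> : (v == tau a) = false by apply: contraNF vK => /eqP ->; apply: imset_f.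
  by have -> : (v == tau b) = false by apply: contraNF vK => /eqP ->; apply: imset_f.
have cut_tau i j : i \in K -> j != i -> j != c ->
    cut (tau b, idx b c) (tau a, idx a c) (idx c a) (idx c b) (old_face (tau i, idx i j))
    = old_face (tau i, idx i j).
  move=> iK ji jc; apply: c5; rewrite !inE !xpair_eqE negb_or !negb_and.
  have tau_eq k l : k \in K -> l \in K -> (tau k == tau l) = (k == l).
    by move=> kK lK; apply/eqP/eqP => [/(flip_inj fl kK lK)|->].
  rewrite !tau_eq //; apply/andP; split.
    have [ib|//] := eqVneq i b; rewrite ib in ji *.
    by rewrite /= idx_eq // (perm5_eqF P).
  have [ia|//] := eqVneq i a; rewrite ia in ji *.
  by rewrite /= idx_eq // (perm5_eqF P).
have g_cut F : g (cut (tau b, idx b c) (tau a, idx a c) (idx c a) (idx c b) F) =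
    cut (tau b, idx b c) (tau a, idx a c) (idx c a) (idx c b) (double_glue F).
  exact: pillow_glue_cut.
(* [A]: faces with a counterpart in [G], transported by [cut]. [B]: the common triangles of [D_c]
   with [D_d], [D_e], inner for the first flip, which become outer faces for the second. *)
pose A F F' := exists2 F0, fcorr K tau tau' (outside K tau iota) F0 F &
  F' = cut (tau b, idx b c) (tau a, idx a c) (idx c a) (idx c b) (old_face F0).
pose B (F : vertex G' * 'I_4) (F' : (vertex G + bool) * 'I_4) := exists2 j, j \in K' &
  (F = (tau' c, idx c j) /\ F' = (inr true, idx c j)) \/
  (F = (tau' j, idx j c) /\ F' = (inr false, idx c j)).
have cut_c i : i \in K -> cut (tau b, idx b c) (tau a, idx a c) (idx c a) (idx c b)
    (old_face (tau i, idx i c)) = (inr true, idx c i).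
  by rewrite !inE => /orP[] /eqP ->.
have corrE F F' : fcorr K' tau' tauY (outside K' tau' iota') F F' <-> A F F' \/ B F F'.
  split.
  - case: F F' => [t k] [t' k'] [[[/= tK ->] <-]|[i [j [iK jK -> ->]]]].
      case: (out' _ tK) => [->|[v vK ->]]; last first.
        left; exists (v, k); first by left.
        by rewrite cut_old // iota_o.
      rewrite iota_c; have [j jc ->] := idxK c k.
      have [jK|jK] := boolP (j \in K).
        by left; exists (tau j, idx j c); [right; exists j, c|rewrite cut_c].
      right; exists j; last by left.
      by move: jK; rewrite nK (negbTE jc).
    move: jK; rewrite nK' => /orP[/eqP ->|jK].
      by right; exists i => //; right; rewrite tauYc.
    left; exists (tau j, idx j i); first by right; exists j, i; rewrite K'K.
    rewrite cut_tau ?tauYK ?K'c //.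
    by apply: contraTneq jK => <-; apply: K'K.
  - case=> [[[t k] [[[/= tK eF] ek]|[i [j [iK jK E EF]]]] ->]|[j jK [[-> ->]|[-> ->]]]].
    + rewrite cut_old //; left; case: F eF ek => [t' k'] /= -> ->.
      by split; rewrite // /outside iota_out' // iota_o.
    + rewrite E EF; move: jK; rewrite nK => /orP[/eqP ->|jK].
        by rewrite cut_c //; left; split=> //; split; rewrite ?iota_c.
      rewrite cut_tau ?K'c //; last by apply: contraTneq iK => <-; apply: K'K.
      right; exists j, i; rewrite tauYK // nK' iK orbT; split=> //.
    + by left; split=> //; split; rewrite ?iota_c.
    + by right; exists j, c; rewrite tauYc.
have g_new b' j : j \in K' -> g (inr b', idx c j) = (inr (~~ b'), idx c j).
  move=> jK; have nj : idx c j \notin [:: idx c a; idx c b].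
    have [ac bc] : a != c /\ b != c by rewrite !Kc.
    have jc := K'c _ jK; have := K'K _ jK.
    by rewrite in_set2 !in_cons in_nil !idx_eq // orbF.
  by rewrite -[(inr b', _)](c6) ?nj ?orbT // g_cut c6 // nj orbT.
split=> //; split.
- by move=> i j /K'K iK /K'K jK; apply: tau'_inj.
- move=> i j; rewrite !in_setC !nK' => /orP[/eqP ->|iK] /orP[/eqP ->|jK] //.
  + by rewrite tauYc tauYK.
  + by rewrite tauYc tauYK.
  + by rewrite !tauYK // => -[] /(flip_inj fl iK jK).
- by move=> v v' [].
- move=> v v' [vK ->]; apply/imsetP => -[j]; rewrite in_setC nK'.
  case: (out' _ vK) => [->|[v2 v2K ->]]; rewrite ?iota_c ?iota_o //.
    by move=> /orP[/eqP ->|jK]; rewrite ?tauYc ?tauYK.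
  move=> /orP[/eqP ->|jK]; rewrite ?tauYc ?tauYK //.
  by case=> E; move: v2K; rewrite E imset_f.
- by move=> v vK; exists (iota' v).
- move=> v' v'K; case: v' v'K => [v|[]] vK.
  + have {}vK : v \notin tau @: K.
      apply: contra vK => /imsetP [i iK ->]; apply/imsetP; exists i; rewrite ?tauYK //.
      by rewrite in_setC nK' iK orbT.
    by exists (iota v); split; rewrite ?iota_out' ?iota_o.
  + by exists (tau' c); split; rewrite ?iota_c.
  + by case/negP: vK; rewrite -[inr false]tauYc imset_f // in_setC.
- by move=> v v1 v2 [_ ->] [_ ->].
- move=> v1 v2 v' [/out' o1 ->] [/out' o2].
  case: o1 => [->|[u1 u1K ->]]; case: o2 => [->|[u2 u2K ->]];
    by rewrite ?iota_c ?iota_o // => -[->].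
- by move=> i j /K'K iK /K'K jK; apply: (flip_glue' fl); apply: inC.
- have ex i j F F' : @glue Y (tauY i, idx i j) = F -> F = (tauY j, idx j i) ->
      @glue Y (tauY i, idx i j) = (tauY j, idx j i) by move=> -> ->.
  have cE i : i \in K -> @glue Y (tauY c, idx c i) = (tauY i, idx i c).
    move=> iK; rewrite glueY tauYc tauYK //.
    have H : g (inr false, idx c i) = cut (tau b, idx b c) (tau a, idx a c) (idx c a) (idx c b)
        (inr true, idx c i) by rewrite -[(inr false, _)]c6 // g_cut.
    by rewrite H; move: iK; rewrite !inE => /orP[] /eqP ->.
  move=> i j; rewrite !in_setC !nK' => /orP[/eqP ->|iK] /orP[/eqP ->|jK] ij.
  + by rewrite eqxx in ij.
  + exact: cE.
  + by rewrite -cE // glueK.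
  + rewrite glueY !tauYK // -[(inl (tau i), _)](cut_tau i j) ?Kc // 1?eq_sym //.
    have := flip_glue fl iK jK ij; rewrite g_cut /double_glue /= => ->.
    by apply: cut_tau => //; apply: Kc.
- move=> F F' /corrE [[F0 FF ->]|[j jK [[-> ->]|[-> ->]]]]; apply/corrE.
  + left; exists (glue F0); first exact: flip_corr fl _ _ FF.
    by rewrite glueY g_cut; case: F0 {FF}.
  + right; exists j => //; right; split; last by rewrite glueY g_new.
    have cj : c != j by rewrite eq_sym K'c.
    exact: (flip_glue' fl (inC _ cK) (inC _ (K'K _ jK)) cj).
  + right; exists j => //; left; split; last by rewrite glueY g_new.
    exact: (flip_glue' fl (inC _ (K'K _ jK)) (inC _ cK) (K'c _ jK)).
Qed.

Lemma hsign0 (X : iograph) (F : vertex X * 'I_4) : hsign F 0 = 0%R.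
Proof. by rewrite /hsign oppr0; case: ifP. Qed.

Lemma opp_valE (K : {set 'I_5}) w (i j : 'I_5) : i \notin K -> opp_val K w i j = w (~: [set i; j]).
Proof.
move=> iK; rewrite /opp_val ifN //; apply: contraNneq iK => <-.
by rewrite !inE eqxx.
Qed.

Lemma opp_val0 (K : {set 'I_5}) w (i j : 'I_5) : #|K| = 2 -> i \in K -> j \in K -> i != j ->
  opp_val K w i j = 0%R.
Proof. by move=> K2 iK jK ij; rewrite /opp_val (card2_eq K2 iK jK ij) eqxx. Qed.

Lemma fcorner_exchange (G : ograph) (t : vertex G) (c i u v : 'I_5) :
  i != c -> u != c -> u != i -> v != c -> v != i ->
  @fcorner G (t, idx i c) (idx (idx c i) (idx c u)) (idx (idx c i) (idx c v)) =
  (t, idx i u, idx i v).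
Proof.
move=> ic uc ui vc vi; have ci : c != i by rewrite eq_sym.
rewrite /fcorner /= !(idx_exchange (i := c)) // !lift_idx ?idx_eq //.
Qed.

(** [Y] is built as a pillow inserted in a shift [X1] of [X], with its half weights dictated by the
    other route, the MP move on [{d, e}] from a shift [X1'] of [X']. What remains is that these
    weights solve the sliding equations. *)
Lemma mp_step (eps : bool) (a b c d e : 'I_5) w w' (X X' : iograph) :
  perm5 a b c d e -> d < e -> ~~ ((a < d) && (b < d)) -> ~~ ((e < a) && (e < b)) ->
  mp_admissible [set a; b] w -> mp_admissible [set d; e] w' ->
  (forall X1 X2 : iograph, cframed X1 -> mp_move (~~ eps) [set d; e] w' X1 X2 ->
     derivable X1 X2) ->
  cframed X -> mp_move eps [set a; b] w X X' -> derivable X X'.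
Proof.
move=> P de low high adm adm' IH frX mv.
have [tau [tau' [iota [fl [s1 s2 s3] mwE]]]] := mp_move_flip mv.
have [h0 hh0] := half_exists X; have [h0' mw] := mwE _ hh0.
set K := [set a; b] in adm mv fl s1 s2 s3 mw *.
set K' := [set d; e] in adm' IH *.
have K2 : #|K| = 2 by rewrite cards2 (perm5_eqF P).
have K2' : #|K'| = 2 by rewrite cards2 (perm5_eqF P).
have frX' : cframed X' := mp_cframed K2 adm fl mw frX.
have [z [za zc N1 N2]] := slide_chain P (erefl K) (erefl K') adm adm'.
have nK j : (j \notin K) = (j == c) || (j \in K').
  by move: j; apply: (perm5_ind P); rewrite !inE ?eqxx ?(perm5_eqF P).
have nK' j : (j \notin K') = (j == c) || (j \in K).
  by move: j; apply: (perm5_ind P); rewrite !inE ?eqxx ?(perm5_eqF P).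
have K'K j : j \in K' -> j \notin K by move=> jK; rewrite nK jK orbT.
have [aK bK] : a \in K /\ b \in K by rewrite !inE !eqxx orbT.
have [dK' eK'] : d \in K' /\ e \in K' by rewrite !inE !eqxx orbT.
have cK : c \notin K by rewrite nK eqxx.
have cK' : c \notin K' by rewrite nK' eqxx.
have inC j : j \notin K -> j \in ~: K by rewrite in_setC.
have tau_eq k l : k \in K -> l \in K -> (tau k == tau l) = (k == l).
  by move=> kK lK; apply/eqP/eqP => [/(flip_inj fl kK lK)|->].
have tau'_eq k l : k \notin K -> l \notin K -> (tau' k == tau' l) = (k == l).
  by move=> kK lK; apply/eqP/eqP => [/(flip_inj' fl (inC _ kK) (inC _ lK))|->].
(* The shifts are the coefficients of the 3-chain, positive in [X] and negative in [X']; the test on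
   [sgn] is that of [hsign_sg5]. Nothing is done at [a] and [c], where [z] is 0. *)
pose y v := if v == tau b then if sgn v then z b else (- z b)%R else 0%R.
pose y' v := if v == tau' d then if sgn v then (- z d)%R else (- - z d)%R
   else if v == tau' e then if sgn v then (- z e)%R else (- - z e)%R else 0%R.
pose X1 := hshift y; pose X1' := hshift y'.
pose h F := (h0 F + hsign F (y F.1))%R.
pose h' F := (h0' F + hsign F (y' F.1))%R.
have hh : @half X1 h := half_hshift (y := y) (mpw_half mw).
have hh' : @half X1' h' := half_hshift (y := y') (mpw_half' mw).
have h_in i j : i \in K -> h (tau i, idx i j) = (h0 (tau i, idx i j) + z i * sg5 i j)%R.
  move=> iK; rewrite /h /y /= tau_eq //; case: (eqVneq i b) => [->|ib].
    by rewrite hsign_sg5.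
  have -> : i = a by move: iK; rewrite !inE (negbTE ib) orbF => /eqP.
  by rewrite hsign0 za mul0r.
have h_in' i j : i \notin K -> h' (tau' i, idx i j) = (h0' (tau' i, idx i j) - z i * sg5 i j)%R.
  have [dK eK] := (K'K _ dK', K'K _ eK').
  move=> iK; rewrite /h' /y' /= !tau'_eq //; case: (eqVneq i d) => [->|id].
    by rewrite hsign_sg5 mulNr.
  case: (eqVneq i e) => [->|ie].
    by rewrite hsign_sg5 mulNr.
  have -> : i = c by move: iK; rewrite nK !inE (negbTE id) (negbTE ie) !orbF => /eqP.
  by rewrite hsign0 zc mul0r oppr0.
have h_out v v' k : outside K tau iota v v' -> h' (v', k) = h (v, k).
  move=> o; rewrite /h /h' (mpw_outside mw _ o); congr (_ + _)%R.
  have vb : (v == tau b) = false by apply: contraNF (flip_notin fl o) => /eqP ->; apply: imset_f.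
  have v'out r : r \in K' -> (v' == tau' r) = false.
    move=> rK'; apply: contraNF (flip_notin' fl o) => /eqP ->.
    exact: imset_f (inC _ (K'K _ rK')).
  by rewrite /y /y' /= vb !v'out // !hsign0.
have ac : a != c by rewrite (perm5_eqF P).
have bc : b != c by rewrite (perm5_eqF P).
have dc : d != c by rewrite (perm5_eqF P).
have ec : e != c by rewrite (perm5_eqF P).
have pq : idx c a != idx c b by rewrite idx_eq ?(perm5_eqF P).
have F12 : (tau b, idx b c) != (tau a, idx a c).
  by rewrite xpair_eqE tau_eq ?(perm5_eqF P).
have rpq : idx c d \notin [:: idx c a; idx c b].
  by rewrite !in_cons in_nil !idx_eq ?(perm5_eqF P).
(* By [odd_idx], the face of [D_i] towards [c] and the face towards [i] of the mirror image of [D_c]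
   are both outgoing or both incoming, so they can be exchanged. *)
have out_ok i : i \in K -> @outgoing X1 (tau i, idx i c) =
    (~~ (eps (+) odd c) == odd (idx c i)).
  move=> iK; have ic : i != c by apply: contraNneq cK => <-.
  rewrite (@outgoingE X1) /= s1 //; have := odd_idx ic.
  by move: (eps) (odd i) (odd c) (odd (idx i c)) (odd (idx c i)); do 5!case.
(* Half weights of the new [D_c], forced by the move from [X1'] to [Y]: its triangles with [D_a],
   [D_b] are inner and must get weight [w'], those with [D_d], [D_e] are outer and gain [w']. *)
pose pc j := if j \in K then (opp_val K' w' j c - h (tau j, idx j c))%R
             else (h' (tau' j, idx j c) + opp_val K' w' j c)%R.
pose hY (F : (vertex X + bool) * 'I_4) := match F.1 with
  | inl v => h (v, F.2)
  | inr true => h' (tau' c, F.2)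
  | inr false => pc (lift c F.2) end.
pose Y := @pillow_iograph X1 (eps (+) odd c) (tau b, idx b c) (tau a, idx a c)
  (idx c a) (idx c b) (idx c d) pq F12 rpq (out_ok b bK) (out_ok a aK) hY.
have [flY iota_c iota_o] := pillow_flip
   (@pillow_glueK X1 _ _ _ _) (pillow_glue_out (out_ok b bK) (out_ok a aK))
   (card_sum_bool_gt0 _) (pillow_connect pq F12 rpq) P fl.
pose tauY : 'I_5 -> vertex Y := pillow_tau tau c.
pose iota' : vertex X1' -> vertex Y := pillow_iota (tau @: K) iota (tau' c).
rewrite -/K -/K' -/iota' in flY iota_c iota_o.
have {}flY : @flip K' X1' Y tau' tauY (outside K' tau' iota') := flY.
have Kc i : i \in K -> i != c by move=> iK; apply: contraNneq cK => <-.
have K'c i : i \in K' -> i != c by move=> iK; apply: contraNneq cK' => <-.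
have hYc0 j : j != c -> hY (inr false, idx c j) = pc j.
  by move=> jc; rewrite /hY /= lift_idx.
have tauYc : tauY c = inr false by rewrite /tauY /pillow_tau eqxx.
have tauYK j : j \in K -> tauY j = inl (tau j).
  by move=> jK; rewrite /tauY /pillow_tau (negbTE (Kc _ jK)).
have pcK j : j \in K -> pc j = (opp_val K' w' j c - h (tau j, idx j c))%R.
  by rewrite /pc => ->.
have pcK' j : j \in K' -> pc j = (h' (tau' j, idx j c) + opp_val K' w' j c)%R.
  by move=> jK; rewrite /pc (negbTE (K'K _ jK)).
have out' v' : v' \notin tau' @: K' ->
    v' = tau' c \/ exists2 v, v \notin tau @: K & v' = iota v.
  move=> v'K; have [/imsetP [j]|/(flip_total' fl) [v [vK ->]]] := boolP (v' \in tau' @: (~: K)).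
    rewrite in_setC nK => /orP[/eqP ->|jK'] E; first by left.
    by move: v'K; rewrite E imset_f.
  by right; exists v.
have mw' : @mp_weights K' w' X1' Y tau' tauY (outside K' tau' iota') h' hY.
  split=> //.
  - exact: half_glued.
  - move=> v' v k [/out' [->|[u uK ->]] ->]; first by rewrite iota_c.
    by rewrite iota_o //; rewrite (h_out u).
  - move=> i j iK; rewrite nK' => /orP[/eqP ->|jK].
      by rewrite tauYc hYc0 ?K'c // pcK' // opp_val_sym opp_valE // setUC.
    have ij : i != j by apply: contraTneq jK => <-; apply: K'K.
    rewrite tauYK // /hY /= h_in // h_in' ?K'K // (mpw_outer mw) ?K'K //.
    have := N1 i j ij (K'c _ iK) (Kc _ jK).
    rewrite (opp_valE _ _ (K'K _ iK)) opp_val_sym opp_valE ?nK' ?jK ?orbT //.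
    rewrite ![[set j; i]]setUC; lra.
  - move=> i j iK jK ij; rewrite !h_in' ?K'K //.
    have := mpw_inner' mw (K'K _ iK) (K'K _ jK) ij.
    have := N1 i j ij (K'c _ iK) (K'c _ jK).
    rewrite (opp_valE _ _ (K'K _ iK)) opp_val0 //; lra.
  - have cin i : i \in K -> (hY (tauY c, idx c i) + hY (tauY i, idx i c))%R = w' (~: [set c; i]).
      move=> iK; rewrite tauYc tauYK // hYc0 ?Kc // pcK // /hY /=.
      by rewrite subrK opp_val_sym opp_valE.
    move=> i j; rewrite !nK' => /orP[/eqP ->|iK] /orP[/eqP ->|jK] ij.
    + by rewrite eqxx in ij.
    + exact: cin.
    + by rewrite addrC cin // setUC.
    + rewrite !tauYK // /hY /= !h_in //.
      have := mpw_inner mw iK jK ij; have := N1 i j ij (Kc _ iK) (Kc _ jK).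
      rewrite (opp_valE (K := K')) ?nK' ?iK ?orbT // opp_val0 //; lra.
(* This supplies the conditions (iii) at the two copies of the edge [de]. *)
have frY : cframed Y := mp_cframed K2' adm' flY mw' (cframed_hshift (y := y') frX').
have slide : slide_move X1 Y.
  (* The sums of half weights over the pillow are exactly the unknowns of the system solved by
     [slide_chain]. *)
  have hsE j : j != c -> (hY (inr false, idx c j) + hY (inr true, idx c j))%R
      = (opp_val K w c j + opp_val K' w' c j - z j * sg5 j c)%R.
    have hYc1 : hY (inr true, idx c j) = h' (tau' c, idx c j) by [].
    move=> jc; rewrite hYc0 // hYc1.
    rewrite h_in' // zc mul0r subr0 ![opp_val _ _ c j]opp_val_sym.
    have [jK|jK] := boolP (j \in K).
      rewrite pcK // h_in // (mpw_outer mw) // (opp_val_sym K) (opp_valE _ _ cK) setUC; ring.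
    have jK' : j \in K' by move: jK; rewrite nK (negbTE jc).
    have := mpw_inner' mw jK cK jc.
    rewrite pcK' // h_in' // (opp_valE w _ jK); lra.
  have cond u v r t : perm5 u v r t c ->
      (sigma (idx c u) (idx c v) (idx c r) * (hY (inr false, idx c t) + hY (inr true, idx c t))
       + sigma (idx c u) (idx c v) (idx c t) * (hY (inr false, idx c r) + hY (inr true, idx c r))
       = dots c u v - (if [set u; v] == K then 1 else 0)
                    - (if [set u; v] == K' then 1 else 0))%R.
    by move=> Q; rewrite !hsE ?(perm5_eqF Q) // !sigma_idx ?(perm5_eqF Q) // N2.
  (* The edges between [d], [e] and [a], [b] are neither [K] nor [K'], which gives (i); the -1 in
     (ii) comes from [ab], the new edge of the pillow. *)
  have mixed u v : u \in K' -> v \in K ->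
      (dots c u v - (if [set u; v] == K then 1 else 0)
                  - (if [set u; v] == K' then 1 else 0) = dots c u v)%R.
    move=> uK vK; rewrite !ifN ?subr0 //; apply/eqP => E.
      have /K'K : v \in K' by rewrite -E !inE eqxx orbT.
      by rewrite vK.
    by move: (K'K _ uK); rewrite -E !inE eqxx.
  have uniq4 : uniq [:: idx c d; idx c e; idx c a; idx c b].
    by rewrite /= !inE !idx_eq ?(perm5_eqF P).
  apply: (@pillow_slide X1 _ _ _ (idx c d) (idx c e) _ _ _ _ _ _ _ _ h) => //.
  - by rewrite lt_idx.
  - by rewrite !lt_idx.
  - by rewrite !lt_idx.
  - by case.
  - rewrite !fcorner_exchange ?(perm5_eqF P) //.
    apply: fcorner_glue_idx; rewrite ?(perm5_eqF P) //.
    by apply: (flip_glue fl) => //; rewrite (perm5_eqF P).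
  - move=> s s'; rewrite !inE => /orP[] /eqP [-> ->].
      by split; rewrite cond ?mixed //; reperm P.
    by split; rewrite cond ?mixed //; reperm P.
  - rewrite cond; last by reperm P.
    rewrite eqxx ifN ?subr0 1?addrC //.
    apply/eqP => E; have /K'K : a \in K' by rewrite -E !inE eqxx.
    by rewrite aK.
  - by apply: frY; rewrite lt_idx.
  - by apply: frY; rewrite lt_idx.
have mv' : mp_move (~~ eps) K' w' X1' Y.
  apply: (mp_move_intro flY _ _ _ mw').
  - by move=> i iK /=; rewrite s2 ?inC ?K'K // addNb.
  - move=> j; rewrite in_setC nK' => /orP[/eqP ->|jK].
      by rewrite tauYc /= addNb negbK.
    by rewrite tauYK //= s1 // addNb negbK.
  - move=> v'; rewrite in_setC => /out' [->|[v vK ->]].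
      by rewrite iota_c /= s2 ?inC // .
    by rewrite iota_o //= s3 // in_setC.
apply: (rst_trans _ _ _ X1); first exact: derivable_hshift.
apply: (rst_trans _ _ _ Y); first by apply: rst_step; apply: by_slide.
apply: (rst_trans _ _ _ X1').
  by apply: rst_sym; apply: IH mv'; apply: cframed_hshift.
by apply: rst_sym; apply: derivable_hshift.
Qed.

(** * The sixteen types *)

Definition primary_pair : {set 'I_5} := [set @Ordinal 5 1 isT; @Ordinal 5 3 isT].

(** For the primary type the dots balance at every edge, the new one included, where they offset the
    Euler term. So an admissible [w] is a 2-cycle. *)
Lemma primary_cobd w (u v x y z : 'I_5) : mp_admissible primary_pair w ->
  perm5 u v x y z -> cobd (opp_val primary_pair w) u v x y z = 0%R.
Proof.
move=> adm P; have := mp_admissible2 adm P.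
suff -> : ((if x \in primary_pair then - dots x u v else dots x u v)
   + (if y \in primary_pair then - dots y u v else dots y u v)
   + (if z \in primary_pair then - dots z u v else dots z u v)
   - (if [set u; v] == primary_pair then 2 else 0) = 0)%R.
  by move/eqP; rewrite mulf_eq0 => /eqP.
have inK (i : 'I_5) : (i \in primary_pair) = ((i == 1 :> nat) || (i == 3 :> nat)).
  by rewrite !inE.
have -> : ([set u; v] == primary_pair) = (u \in primary_pair) && (v \in primary_pair).
  apply/eqP/andP => [<-|[uK vK]]; first by rewrite !inE !eqxx orbT.
  by apply: card2_eq => //; rewrite ?cards2 // (perm5_eqF P).
rewrite !inK /dots !val_idx ?(perm5_eqF P) //; move/uniq_map_ord: P => /=.
pose K1 n := (n == 1) || (n == 3).
pose dt i u v : int := dotted (unbump i u) (unbump i v).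
have H : all5 (fun u => all5 (fun v => all5 (fun x => all5 (fun y => all5 (fun z =>
  uniq [:: u; v; x; y; z] ==>
  ((if K1 x then - dt x u v else dt x u v) + (if K1 y then - dt y u v else dt y u v)
    + (if K1 z then - dt z u v else dt z u v) - (if K1 u && K1 v then 2 else 0) == 0)%R))))).
  by vm_compute.
have /implyP {}H := all5P (all5P (all5P (all5P (all5P H u) v) x) y) z.
by move=> /H /eqP.
Qed.

(** A 2-cycle of the simplex is a boundary, so H-moves with the coefficients of a bounding 3-chain
    reduce any admissible [w] to 0. *)
Lemma mp_primary w (X X' : iograph) : mp_admissible primary_pair w ->
  mp_move false primary_pair w X X' -> derivable X X'.
Proof.
move=> adm mv.
have [tau [tau' [iota [fl [s1 s2 s3] mwE]]]] := mp_move_flip mv.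
have [h0 hh0] := half_exists X; have [h0' mw] := mwE _ hh0.
set K := primary_pair in adm mv fl s1 s2 s3 mw *.
pose a : 'I_5 := @Ordinal 5 1 isT; pose b : 'I_5 := @Ordinal 5 3 isT.
have K2 : #|K| = 2 by rewrite cards2.
have [aK bK] : a \in K /\ b \in K by rewrite !inE !eqxx.
pose U := opp_val K w.
have Us i j : U i j = U j i := opp_val_sym K w i j.
pose z i := if i == a then 0%R else cone U a i.
(* The coefficient of [b] vanishes because [opp_val] is 0 on the triangle opposite to [a] and [b];
   H-moves are needed only at the three new vertices. *)
have z0 i : i \in K -> z i = 0%R.
  by move=> iK; rewrite /z; have [//|ia] := eqVneq i a; rewrite /cone /U opp_val0 ?mul0r // eq_sym.
have N i j : i != j -> U i j = (z i * sg5 i j + z j * sg5 j i)%R.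
  have apex k : k != a -> U a k = (z a * sg5 a k + z k * sg5 k a)%R.
    by move=> ka; rewrite /z (negbTE ka) eqxx mul0r add0r /cone -mulrA sg5_sq mulr1.
  move=> ij; have [ia|ia] := eqVneq i a; first by rewrite ia apex // -ia eq_sym.
  have [ja|ja] := eqVneq j a; first by rewrite ja Us addrC apex // -ja.
  have [x [y [t P]]] := perm5_exists ij.
  have [c [k Q]] : exists c k, perm5 c k a i j.
    move: (perm5P P a); rewrite ![a == _]eq_sym (negbTE ia) (negbTE ja) /=.
    case/or3P => /eqP <-; [exists y, t|exists x, t|exists x, y]; reperm P.
  rewrite (opp_val_cone Us Q); last exact: primary_cobd adm Q.
  by rewrite /z (negbTE ia) (negbTE ja) /cone.
have inC j : j \notin K -> j \in ~: K by rewrite in_setC.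
pose y' (v : vertex X') : int :=
  if [pick j | (j \notin K) && (tau' j == v)] is Some j
  then if sgn v then (- z j)%R else (- - z j)%R else 0%R.
pose h' F := (h0' F + hsign F (y' F.1))%R.
have h_in' i j : i \notin K -> h' (tau' i, idx i j) = (h0' (tau' i, idx i j) - z i * sg5 i j)%R.
  move=> iK; rewrite /h' /y' /=; case: pickP => [k /andP[kK /eqP E]|/(_ i)]; last by rewrite iK eqxx.
  by rewrite (flip_inj' fl (inC _ kK) (inC _ iK) E) hsign_sg5 mulNr.
have mw' : @mp_weights K (fun _ => 0%R) X (hshift y') tau tau' (outside K tau iota) h0 h'.
  split.
  - exact: mpw_half mw.
  - exact: half_hshift (mpw_half' mw).
  - move=> v v' k o; rewrite -(mpw_outside mw _ o) /h' /y' /=.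
    case: pickP => [j /andP[jK /eqP E]|_]; last by rewrite hsign0 addr0.
    by move: (flip_notin' fl o); rewrite -E imset_f // inC.
  - move=> i j iK jK; rewrite h_in' // (mpw_outer mw) //.
    have ij : i != j by apply: contraNneq jK => <-.
    have := N i j ij; rewrite z0 // /U opp_val_sym opp_valE // setUC; lra.
  - exact: mpw_inner mw.
  - move=> i j iK jK ij; rewrite !h_in' //.
    have := mpw_inner' mw iK jK ij; have := N i j ij; rewrite /U opp_valE //; lra.
apply: (rst_trans _ _ _ (hshift y')); last exact/rst_sym/derivable_hshift.
apply/rst_step/by_primary_mp; rewrite /primary_mp_move.
have mv' : mp_move false K (fun=> 0%R) X (hshift y').
  exact: (@mp_move_intro false K _ X (hshift y') tau tau' iota h0 h' fl s1 s2 s3 mw').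
exact: mv'.
Qed.

(** Quantified over all admissible [w], so that the auxiliary type of a reduction may be used with
    whichever function is at hand. *)
Definition mp_derivable (eps : bool) (K : {set 'I_5}) : Prop :=
  forall w (X X' : iograph), mp_admissible K w -> cframed X ->
    mp_move eps K w X X' -> derivable X X'.

Lemma mp_derivable_step (a b c d e : 'I_5) :
  perm5 a b c d e -> d < e -> ~~ ((a < d) && (b < d)) -> ~~ ((e < a) && (e < b)) ->
  (exists w, mp_admissible [set d; e] w) ->
  forall eps, mp_derivable (~~ eps) [set d; e] -> mp_derivable eps [set a; b].
Proof.
move=> P de low high [w' adm'] eps IH w X X' adm frX mv.
by apply: (mp_step P de low high adm adm' _ frX mv) => X1 X2; apply: IH.
Qed.

Lemma mp_type_set2 (a b : 'I_5) : a != b -> (1 < a) || (1 < b) ->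
  (a < 3) || (b < 3) -> mp_type [set a; b].
Proof.
move=> ab ab1 ab3; split; first by rewrite cards2 ab.
  move=> H; have in01 (i : 'I_5) : i <= 1 -> i \in [set a; b].
    move=> i1; apply: contraT => iK; case/orP: ab1 => x1.
      by have := H a i; rewrite set21 iK => /(_ isT isT); lia.
    by have := H b i; rewrite set22 iK => /(_ isT isT); lia.
  have := in01 (@Ordinal 5 0 isT) isT; have := in01 (@Ordinal 5 1 isT) isT.
  by rewrite !inE -!val_eqE /=; lia.
move=> H; have in34 (i : 'I_5) : 3 <= i -> i \in [set a; b].
  move=> i3; apply: contraT => iK; case/orP: ab3 => x3.
    by have := H a i; rewrite set21 iK => /(_ isT isT); lia.
  by have := H b i; rewrite set22 iK => /(_ isT isT); lia.
have := in34 (@Ordinal 5 3 isT) isT; have := in34 (@Ordinal 5 4 isT) isT.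
by rewrite !inE -!val_eqE /=; lia.
Qed.

Definition edge5 (m n : nat) : {set 'I_5} := [set inord m; inord n].

Lemma mp_typeP (K : {set 'I_5}) : mp_type K -> exists m n : nat,
  [/\ K = edge5 m n & (m, n) \in
      [:: (0, 2); (0, 3); (0, 4); (1, 2); (1, 3); (1, 4); (2, 3); (2, 4)]].
Proof.
move=> [/eqP/cards2P [a [b [ab ->]]] low high].
wlog lt_ab : a b ab low high / a < b.
  have [lt|lt|/val_inj e] := ltngtP a b; last by rewrite e eqxx in ab.
    by apply.
  rewrite setUC in low high *; apply => //; by rewrite eq_sym.
exists a, b; split; first by rewrite /edge5 !inord_val.
have low' : ~~ ((a == 0 :> nat) && (b == 1 :> nat)).
  apply/negP => /andP[/eqP a0 /eqP b1]; apply: low => i j.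
  rewrite !inE negb_or => /orP[] /eqP -> /andP[]; rewrite -!val_eqE /= a0 b1; lia.
have high' : ~~ ((a == 3 :> nat) && (b == 4 :> nat)).
  apply/negP => /andP[/eqP a0 /eqP b1]; apply: high => i j.
  rewrite !inE negb_or => /orP[] /eqP -> /andP[]; rewrite -!val_eqE /= a0 b1;
  have := ltn_ord j; lia.
by move: low' high' lt_ab; clear; case_ord a; case_ord b.
Qed.

(* w eps K is the function fixed for the MP move of type (eps, K). *)
Theorem theorem3p3 (R : realType)
    (w : bool -> {set 'I_5} -> {set 'I_5} -> int)
    (hw : forall (eps : bool) (K : {set 'I_5}),
        mp_type K -> mp_admissible K (w eps K))
    (eps : bool) (K : {set 'I_5}) (hK : mp_type K)
    (X X' : iograph) (hX : framed R X) (hX' : framed R X')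
    (hmp : mp_move eps K (w eps K) X X') :
  derivable X X'.
Proof.
suff H : mp_derivable eps K by exact: H (hw eps K hK) (proj2 hX) hmp.
have step a b c d e : uniq [:: a; b; c; d; e] -> all (ltn^~ 5) [:: a; b; c; d; e] ->
   [&& d < e, ~~ ((a < d) && (b < d)), ~~ ((e < a) && (e < b)), 1 < e & d < 3] ->
   forall eps, mp_derivable (~~ eps) (edge5 d e) -> mp_derivable eps (edge5 a b).
  move=> U lt5 /and5P[de low high e1 d3] eps'.
  have E n : n \in [:: a; b; c; d; e] -> (inord n : 'I_5) = n :> nat.
    by move=> /(allP lt5) n5; rewrite inordK.
  have [Ea Eb Ec Ed Ee] : [/\ (inord a : 'I_5) = a :> nat, (inord b : 'I_5) = b :> nat,
      (inord c : 'I_5) = c :> nat, (inord d : 'I_5) = d :> nat & (inord e : 'I_5) = e :> nat].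
    by split; apply: E; rewrite !inE eqxx ?orbT.
  have P : perm5 (inord a) (inord b) (inord c) (inord d) (inord e).
    by rewrite /perm5 -(map_inj_uniq val_inj) /= Ea Eb Ec Ed Ee.
  apply: (mp_derivable_step P); rewrite ?Ea ?Eb ?Ed ?Ee //.
  (* Admissibility does not involve [eps], so the function fixed for either sign will do; [1 < e]
     and [d < 3] exclude the pairs 01 and 34. *)
  exists (w true (edge5 d e)); apply/hw/mp_type_set2; rewrite ?(perm5_eqF P) ?Ed ?Ee ?e1 ?d3 ?orbT //.
have f13 : mp_derivable false (edge5 1 3).
  have -> : edge5 1 3 = primary_pair.
    by rewrite /edge5; congr [set _; _]; apply: val_inj; rewrite /= inordK.
  by move=> w1 X1 X2 adm _; apply: mp_primary.
(* Each edge of the graph of disjoint pairs flips the sign. The pairs are first reached from 13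
   along shortest paths, with the sign given by the parity of the distance. *)
have t02 : mp_derivable true (edge5 0 2).
  exact: (step 0 2 4 1 3 isT isT isT true f13).
have t04 : mp_derivable true (edge5 0 4).
  exact: (step 0 4 2 1 3 isT isT isT true f13).
have t24 : mp_derivable true (edge5 2 4).
  exact: (step 2 4 0 1 3 isT isT isT true f13).
have f14 : mp_derivable false (edge5 1 4).
  exact: (step 1 4 3 0 2 isT isT isT false t02).
have f12 : mp_derivable false (edge5 1 2).
  exact: (step 1 2 3 0 4 isT isT isT false t04).
have f23 : mp_derivable false (edge5 2 3).
  exact: (step 2 3 1 0 4 isT isT isT false t04).
have f03 : mp_derivable false (edge5 0 3).
  exact: (step 0 3 1 2 4 isT isT isT false t24).
(* The disjoint pairs 14 and 23 were reached with the same sign: their edge closes the 5-cycle 13,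
   02, 14, 23, 04. From here on, every pair is reached with its second sign. *)
have t23 : mp_derivable true (edge5 2 3).
  exact: (step 2 3 0 1 4 isT isT isT true f14).
have t03 : mp_derivable true (edge5 0 3).
  exact: (step 0 3 2 1 4 isT isT isT true f14).
have t14 : mp_derivable true (edge5 1 4).
  exact: (step 1 4 0 2 3 isT isT isT true f23).
have t12 : mp_derivable true (edge5 1 2).
  exact: (step 1 2 4 0 3 isT isT isT true f03).
have f02 : mp_derivable false (edge5 0 2).
  exact: (step 0 2 3 1 4 isT isT isT false t14).
have f04 : mp_derivable false (edge5 0 4).
  exact: (step 0 4 3 1 2 isT isT isT false t12).
have f24 : mp_derivable false (edge5 2 4).
  exact: (step 2 4 1 0 3 isT isT isT false t03).
have t13 : mp_derivable true (edge5 1 3).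
  exact: (step 1 3 4 0 2 isT isT isT true f02).
have [m [n [-> ]]] := mp_typeP hK; rewrite !inE.
by case: eps {hmp}; do 7![case/orP => [/eqP[-> ->] //|]]; move=> /eqP[-> ->].
Qed.
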